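(* Let $\omega=\omega(n)=o(\log n)$ be a function tending to infinity with $n$. Let $p=p(n)$ satisfy \[ \left(\frac{2\log n + \omega}{n}\right)^{1/2} \le p \le 1 - \frac{3\log \log n}{\log n}, \qquad \eta=\frac{\log(1/p)}{\log n}, \] let $q=1-p$, $\rho=p^2+q^2$, and let $c$ be a positive constant such that \[ 0< c < \min\left\{ \frac{1}{2}\left( \frac{\log n - 3\log\log n}{\log(1/p)} - 1\right), 1 \right\}. \] Then asymptotically almost surely \[ \left(1 - 2\eta-\frac{4\log\log n}{\log n}\right) \frac{2\log n}{\log (1/\rho)}\le \zeta(G_{n,p})\le (1 - c\eta) \frac{2\log n}{\log (1/\rho)}. \]
   Context: $G_{n,p}$ is the Erdős–Rényi random graph on vertex set $[n]$ where each pair is an edge independently with probability $p$. Localization game on a graph $G$: a robber occupies an (unknown to the cop) vertex $v$. In each round the cop chooses a set $W=\{w_1,\dots,w_k\}$ of $k$ vertices (a new set may be chosen each round) and is told the distances $\mathrm{dist}(v,w_i)$, $i=1,\dots,k$ (the $W$-signature of $v$). The cop wins if this information (together with information from previous rounds) determines $v$ exactly; otherwise the robber moves to a neighbor of its current vertex and a new round starts. The localization number $\zeta(G)$ is the minimum $k$ such that the cop, using test sets of size $k$, has a strategy guaranteeing to eventually determine the robber's location. ''Asymptotically almost surely'' (a.a.s.) means with probability tending to $1$ as $n\to\infty$. All logarithms are natural. *)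

(* Defs.v *)
From mathcomp Require Import all_boot all_order all_algebra.
From mathcomp Require Import boolp reals topology normedtype sequences exp.
Set Implicit Arguments.
Unset Strict Implicit.
Unset Printing Implicit Defensive.
Import Order.TTheory GRing.Theory Num.Theory.
Local Open Scope ring_scope.

Definition vpair (T : finType) : finType := {e : {set T} | #|e| == 2%N}.

(* A simple graph on T, given by its edge set. *)
Definition graph (T : finType) : finType := {set vpair T}.

Definition adj (T : finType) (G : graph T) (u v : T) : bool :=
  [exists e in G, val e == [set u; v]].

Definition has_walk (T : finType) (G : graph T) (u v : T) (d : nat) : bool :=
  [exists w : d.-tuple T, path (adj G) u w && (last u w == v)].

(* Finite distances are < #|T|; the value #|T| encodes infinite distance. *)
Definition dist (T : finType) (G : graph T) (u v : T) : nat :=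
  find (has_walk G u v) (iota 0 #|T|).

(* The distances are listed in the fixed order of enum, so for a known W this
   list is the map w |-> dist v w on W. *)
Definition signature (T : finType) (G : graph T) (W : {set T}) (v : T) :
    seq nat :=
  [seq dist G v w | w <- enum W].

(* The robber must move along an edge; only at an isolated vertex, where this
   is impossible, does it stay in place. *)
Definition robber_move (T : finType) (G : graph T) (u v : T) : bool :=
  adj G u v || (u == v) && [forall w, ~~ adj G u w].

Definition robber_walk (T : finType) (G : graph T) (r : nat -> T) : Prop :=
  forall t, robber_move G (r t) (r t.+1).

(* The next test set as a function of the signatures received so far. *)
Definition strategy (T : finType) : Type := seq (seq nat) -> {set T}.

(* The signatures received in rounds 0, ..., t - 1 when the cop follows s and
   the robber is at r i in round i. *)
Fixpoint history (T : finType) (G : graph T) (s : strategy T) (r : nat -> T)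
    (t : nat) : seq (seq nat) :=
  if t is t'.+1 then
    let h := history G s r t' in rcons h (signature G (s h) (r t'))
  else [::].

(* All robber walks compatible with what was revealed in rounds 0, ..., t are
   at the same vertex in round t. *)
Definition located (T : finType) (G : graph T) (s : strategy T) (r : nat -> T)
    (t : nat) : Prop :=
  forall r' : nat -> T, robber_walk G r' ->
    history G s r' t.+1 = history G s r t.+1 -> r' t = r t.

Definition cop_wins (T : finType) (G : graph T) (k : nat) : Prop :=
  exists s : strategy T,
    (forall h, #|s h| = k) /\
    (forall r : nat -> T, robber_walk G r -> exists t, located G s r t).

Lemma dist_eq0 (T : finType) (G : graph T) (u v : T) :
  (dist G u v == 0%N) = (u == v).
Proof.
have T_gt0 : (0 < #|T|)%N by apply/card_gt0P; exists u.
rewrite /dist; case: #|T| T_gt0 => // n _ /=.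
have -> : has_walk G u v 0 = (u == v).
  apply/existsP/idP => [[w]|uv]; first by rewrite tuple0.
  by exists [tuple].
by case: (u == v).
Qed.

Lemma cop_wins_card (T : finType) (G : graph T) : cop_wins G #|T|.
Proof.
exists (fun=> setT); split=> [h|r _]; first by rewrite cardsT.
exists 0%N => r' _ /= [] /eq_in_map E.
apply/eqP; rewrite -(dist_eq0 G) E ?mem_enum ?inE //.
by rewrite dist_eq0.
Qed.

Lemma ex_cop_wins (T : finType) (G : graph T) :
  exists k, `[< cop_wins G k >].
Proof. by exists #|T|; apply/asboolP/cop_wins_card. Qed.

Definition loc_number (T : finType) (G : graph T) : nat :=
  ex_minn (ex_cop_wins G).

Definition gnp_pmf (R : realType) (n : nat) (p : R) (G : graph 'I_n) : R :=
  \prod_(e : vpair 'I_n) (if e \in G then p else 1 - p).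

Definition gnp_pr (R : realType) (n : nat) (p : R) (A : pred (graph 'I_n)) : R :=
  \sum_(G : graph 'I_n | A G) gnp_pmf p G.

Lemma gnp_pr_total (R : realType) (n : nat) (p : R) :
  gnp_pr p (@predT (graph 'I_n)) = 1.
Proof.
rewrite /gnp_pr /gnp_pmf.
transitivity (\prod_(e : vpair 'I_n) (p + (1 - p))).
  by rewrite bigA_distr; apply: eq_bigr => G _; rewrite big_mkcond.
by rewrite big1 // => e _; rewrite addrC subrK.
Qed.

Definition eta (R : realType) (n : nat) (p : R) : R := ln (1 / p) / ln n%:R.

Definition rho (R : realType) (p : R) : R := p ^+ 2 + (1 - p) ^+ 2.

(* Main.v *)
(* Upper bound. With q = 1 - p, a random vertex fails to separate two given
   vertices with probability rho = p^2 + q^2, and a.a.s. this holds for all pairs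
   simultaneously up to a factor 1 + O(pq / log n). Hence k greedily chosen vertices
   leave O(|A|^2 rho^k) unseparated pairs in a set A, where
   rho^k ~ n^-2 p^-2c. If p is below a constant depending on c, then from a set S
   of candidates the robber can reach at most 4np|S| vertices, and the new class
   has size O(p^(1-c) |S|) < |S|: the candidates shrink to one. If p is above
   that constant, boundedly many pairs are left after k - l steps, and l further
   vertices with prescribed adjacencies separate them all, so that one test
   suffices.

   Lower bound. It is trivial unless np^2 >= log^4 n; then the diameter is at most
   2 and signatures amount to adjacencies. For a vertex v and a test set W, the
   adjacencies to W of the neighbours of v are independent words with collision
   probability rho^|W|. A birthday bound shows that two of them coincide, except
   with a probability exp(- log^4 n / (32 p)) that is small enough for a union bound
   over all v and W. So the robber always has two indistinguishable moves. *)
Require Import Defs.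
From mathcomp Require Import all_boot all_order all_algebra.
From mathcomp Require Import boolp reals topology normedtype landau sequences exp.
From mathcomp Require Import ring lra zify.
Import Order.TTheory GRing.Theory Num.Theory.
Import numFieldNormedType.Exports.
Local Open Scope ring_scope.
Local Open Scope classical_set_scope.
Set Implicit Arguments.
Unset Strict Implicit.
Unset Printing Implicit Defensive.

(** * Distances and the game *)

Section Distances.
Variables (T : finType) (G : graph T).
Implicit Types u v w : T.

Lemma adj_sym u v : adj G u v = adj G v u.
Proof. by rewrite /adj; under eq_existsb => e do rewrite finset.setUC. Qed.

Lemma adj_irr u : adj G u u = false.
Proof.
apply/existsP => -[e /andP[_ /eqP ve]].
by have := valP e; rewrite /= ve finset.setUid cards1.
Qed.

Lemma adj_neq u v : adj G u v -> u != v.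
Proof. by apply: contraTneq => ->; rewrite adj_irr. Qed.

Lemma has_walk0 u v : has_walk G u v 0 = (u == v).
Proof.
apply/existsP/idP => [[w]|uv]; first by rewrite tuple0.
by exists [tuple].
Qed.

Lemma has_walk1 u v : has_walk G u v 1 = adj G u v.
Proof.
apply/existsP/idP => [[w]|uv].
  by case/tupleP: w => x w; rewrite tuple0 /= andbT => /andP[a /eqP <-].
by exists [tuple v]; rewrite /= uv eqxx.
Qed.

Lemma dist_eq1 u v : u != v -> (dist G u v == 1%N) = adj G u v.
Proof.
move=> uv; rewrite /dist.
have : (1 < #|T|)%N.
  by have := max_card [set u; v]%SET; rewrite cards2 uv.
case: #|T| => [|[|n]] // _ /=.
by rewrite has_walk0 has_walk1 (negbTE uv); case: adj.
Qed.

Lemma dist_eq2 u v w : u != v -> ~~ adj G u v -> adj G u w -> adj G w v ->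
  dist G u v = 2%N.
Proof.
move=> uv nuv uw wv; rewrite /dist.
have : (2 < #|T|)%N.
  have <- : #|[set u; v; w]%SET| = 3%N.
    rewrite finset.setUC cardsU1 cards2 uv !inE.
    by rewrite eq_sym (negbTE (adj_neq uw)) (negbTE (adj_neq wv)).
  exact: max_card.
case: #|T| => [|[|[|n]]] // _ /=.
rewrite has_walk0 has_walk1 (negbTE uv) (negbTE nuv).
rewrite (_ : has_walk G u v 2) //.
by apply/existsP; exists [tuple w; v]; rewrite /= uw wv eqxx.
Qed.

Lemma signatureP (W : {set T}) x y :
  reflect {in W, forall w, dist G x w = dist G y w}
          (signature G W x == signature G W y).
Proof.
apply: (iffP eqP) => [/eq_in_map E w wW|E]; first by apply: E; rewrite mem_enum.
by apply/eq_in_map => w; rewrite mem_enum; apply: E.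
Qed.

End Distances.

(** * The localization game: winning strategies for the cop and for the robber *)

Section Game.
Variables (T : finType) (G : graph T).

Definition moves (S : {set T}) : {set T} :=
  [set y | [exists x in S, robber_move G x y]].

(** Lets round 0 be treated like the others, with all vertices as the state before it: each vertex
    is entered from a neighbour or, when isolated, from itself. *)
Lemma movesT : moves [set: T] = [set: T].
Proof.
apply/setP => y; rewrite !inE; apply/existsP.
case: (boolP [forall w, ~~ adj G y w]) => [iso|].
  by exists y; rewrite inE /robber_move eqxx iso orbT.
rewrite negb_forall => /existsP[w]; rewrite negbK => yw.
by exists w; rewrite inE /robber_move adj_sym yw.
Qed.

Lemma robber_moveE x : exists y, robber_move G x y.
Proof.
case: (boolP [forall w, ~~ adj G x w]) => [iso|].
  by exists x; rewrite /robber_move eqxx iso orbT.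
rewrite negb_forall => /existsP[w]; rewrite negbK => xw.
by exists w; rewrite /robber_move xw.
Qed.

(* The cop remembers the set S of vertices compatible with all answers so far;
   before the next test the candidates are [moves S]. *)
Lemma cop_wins_shrink (k : nat) :
  (forall S : {set T}, exists W : {set T}, #|W| = k /\
    forall x, x \in moves S ->
      let C := [set y in moves S | signature G W y == signature G W x] in
      (#|C| <= 1)%N || (#|C| < #|S|)%N) ->
  cop_wins G k.
Proof.
move=> /choice[W HW].
pose step (S : {set T}) (sg : seq nat) :=
  [set y in moves S | signature G (W S) y == sg].
pose state (h : seq (seq nat)) := foldl step [set: T] h.
exists (fun h => W (state h)); split=> [h|r rw]; first by have [] := HW (state h).
set s : strategy T := fun h => W (state h).
have stS r' t : state (history G s r' t.+1) =
    step (state (history G s r' t)) (signature G (s (history G s r' t)) (r' t)).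
  by rewrite /state /= -cats1 foldl_cat.
have mem_moves r' : robber_walk G r' -> forall t,
    r' t \in moves (state (history G s r' t)).
  move=> rw'; elim=> [|t IH]; first by rewrite movesT inE.
  rewrite inE; apply/existsP; exists (r' t); rewrite rw' andbT stS.
  by rewrite inE IH eqxx.
have mem_state r' : robber_walk G r' -> forall t,
    r' t \in state (history G s r' t.+1).
  by move=> rw' t; rewrite stS inE mem_moves // eqxx.
(* While the state has two or more elements after every test, it loses a vertex in each round, which
   is impossible for more than [#|T|] rounds. *)
have [t Ht] : exists t, (#|state (history G s r t.+1)| <= 1)%N.
  apply: contrapT => /forallNP H.
  suff : forall t, (#|state (history G s r t)| + t <= #|T|)%N.
    move=> /(_ #|T|.+1); lia.
  elim=> [|t IH]; first by rewrite /state /= cardsT addn0.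
  have [_ /(_ _ (mem_moves r rw t))] := HW (state (history G s r t)).
  have /negP := H t; rewrite stS /step /= => /negbTE -> /=.
  by move=> h; rewrite addnS; apply: leq_trans IH; rewrite -addSn leq_add2r.
exists t => r' rw' Hh.
apply: (card_le1_eqP Ht); first exact: (mem_state r rw t).
by rewrite -Hh; exact: (mem_state r' rw' t).
Qed.

(* The robber moves to one of two neighbours x, y with the same signature: the
   walk that deviates only now, to the other one, has the same history. *)
Lemma robber_wins (k : nat) :
  (forall v (W : {set T}), #|W| = k -> exists x y, [/\ x != y, adj G v x,
     adj G v y & signature G W x = signature G W y]) ->
  ~ (#|T| = 0)%N -> ~ cop_wins G k.
Proof.
move=> twins T0 [s [sk win]].
have [v0 _] : exists v0 : T, v0 \in [set: T].
  by apply/card_gt0P; rewrite cardsT; case: #|T| T0.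
have /choice[f Hf] : forall vW : T * {set T}, exists xy : T * T, #|vW.2| = k ->
    [/\ xy.1 != xy.2, adj G vW.1 xy.1, adj G vW.1 xy.2 &
     signature G vW.2 xy.1 = signature G vW.2 xy.2].
  move=> [v W]; have [Wk|Wk] := eqVneq #|W| k; last first.
    by exists (v, v) => /= /eqP; rewrite (negbTE Wk).
  by have [x [y H]] := twins v W Wk; exists (x, y).
have /choice[mv Hmv] := robber_moveE.
(* Vertex and history are built together: the next test set [s h'] depends only on answers already
   given, so the robber knows it before moving. [v0] is a fictitious position before round 0. *)
pose fix play (t : nat) : T * seq (seq nat) :=
  if t is t'.+1 then
    let: (v, h) := play t' in
    let h' := rcons h (signature G (s h) v) in
    ((f (v, s h')).1, h')
  else ((f (v0, s [::])).1, [::]).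
pose r t := (play t).1.
have hist t : (play t).2 = history G s r t.
  elim: t => //= t <-; rewrite /r; by case: (play t).
pose prev t := if t is t'.+1 then r t' else v0.
have rE t : r t = (f (prev t, s (history G s r t))).1.
  case: t => [//|t]; rewrite /= -hist /r /=.
  by case: (play t) => v h.
have adjr t : adj G (prev t) (r t).
  by rewrite [r t]rE; have [] := Hf (prev t, s (history G s r t)) (sk _).
have rw : robber_walk G r by move=> t; rewrite /robber_move (adjr t.+1).
have [t Ht] := win r rw.
pose y := (f (prev t, s (history G s r t))).2.
have [xy _ ay sg] := Hf (prev t, s (history G s r t)) (sk _).
(* The deviating walk goes to [y] in round [t] and then on by arbitrary legal moves. *)
pose r' i := if (i < t)%N then r i else iter (i - t) mv y.
have rw' : robber_walk G r'.
  move=> i; rewrite /r'; case: (ltnP i t) => it.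
    case: (ltnP i.+1 t) => it'; first exact: rw.
    have e : t = i.+1 by lia.
    by rewrite e subnn /=; move: ay; rewrite -/y e /robber_move /= => ->.
  by rewrite ltnNge leqW //= subSn //= Hmv.
have hE i : (i <= t)%N -> history G s r' i = history G s r i.
  by elim: i => //= i IH it; rewrite IH 1?ltnW // (_ : r' i = r i) // /r' it.
have r't : r' t = y by rewrite /r' ltnn subnn.
have := Ht r' rw'; rewrite /= (hE t) // r't /y -sg -rE => /(_ erefl) E.
by move: xy; rewrite -rE E eqxx.
Qed.

End Game.

(** * The law of traces in G(n,p) *)

Lemma adj_edge (T : finType) (G : graph T) (e : vpair T) u v :
  val e = [set u; v]%SET -> adj G u v = (e \in G).
Proof.
move=> ve; apply/existsP/idP => [[e' /andP[e'G /eqP ve']]|eG].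
  by rewrite (_ : e = e') //; apply: val_inj; rewrite ve ve'.
by exists e; rewrite eG ve eqxx.
Qed.

Definition nbrs (T : finType) (G : graph T) (v : T) : {set T} :=
  [set u | adj G v u].

Section Gnp.
Variables (R : realType) (n : nat) (p : R).
Local Notation V := 'I_n.
Implicit Types (G : graph V) (U W S : {set V}).

Definition gnp_mean (f : graph V -> R) : R :=
  \sum_(G : graph V) gnp_pmf p G * f G.

(* The law of N(w) :&: U for w outside U, extended by 0 to the sets that are not
   included in U, so that sums may range over all sets. *)
Definition trace_wt U S : R :=
  \prod_u (if u \in S then (if u \in U then p else 0)
           else (if u \in U then 1 - p else 1)).

Lemma gnp_pr_edges (D F : {set vpair V}) : F \subset D ->
  gnp_pr p (fun G => G :&: D == F)
  = \prod_(e in D) (if e \in F then p else 1 - p).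
Proof.
move=> /subsetP FD.
(* The weights of presence and of absence of an edge, put to 0 where they contradict [F] on [D]:
   expanding the product leaves exactly the graphs with [G :&: D = F], and outside [D] each factor
   is 1. *)
pose a e := if (e \in D) && (e \notin F) then 0 else p.
pose b e := if e \in F then 0 else 1 - p.
transitivity (\prod_e (a e + b e)).
  rewrite bigA_distr /gnp_pr /= [RHS](bigID (fun G => G :&: D == F)) /=.
  rewrite [X in _ = _ + X]big1 ?addr0.
    apply: eq_bigr => G /eqP GF; apply: eq_bigr => e _.
    have := congr1 (fun A : {set _} => e \in A) GF; rewrite inE /a /b.
    by case: (e \in G) => /= <-; case: (e \in D).
  move=> G GF; apply/eqP/prodf_eq0.
  have /existsP[e He] : [exists e, (e \in G :&: D) != (e \in F)].
    apply: contraNT GF; rewrite negb_exists => /forallP H.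
    by apply/eqP/setP => e; have := H e; rewrite negbK => /eqP.
  exists e => //; move: He; rewrite inE /a /b.
  case: (e \in G) => /=.
    case: (boolP (e \in F)) => [/FD ->|] //=.
    by case: (e \in D); rewrite ?eqxx.
  by case: (e \in F).
rewrite (bigID (mem D)) /= mulrC big1 ?mul1r.
  apply: eq_bigr => e eD; rewrite /a /b eD /=.
  by case: (e \in F); rewrite ?addr0 ?add0r.
move=> e eD; rewrite /a /b (negbTE eD) /=.
by rewrite ifN 1?addrC 1?subrK //; apply: contra eD => /FD.
Qed.

Lemma trace_wt_sub U S : S \subset U ->
  trace_wt U S = \prod_(u in U) (if u \in S then p else 1 - p).
Proof.
move=> /subsetP SU; rewrite [RHS]big_mkcond; apply: eq_bigr => u _ /=.
by case: (boolP (u \in S)) => [/SU ->|] //.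
Qed.

Lemma trace_wt_nsub U S : ~~ (S \subset U) -> trace_wt U S = 0.
Proof.
move=> /subsetPn[u uS uU]; apply/eqP/prodf_eq0.
by exists u => //; rewrite uS (negbTE uU).
Qed.

(** A cut edge between [U] and its complement is seen only by the trace of its endpoint outside [U];
    prescribing all traces thus amounts to prescribing the cut edges. If some [f w] is not included
    in [U], both sides vanish. *)
Lemma gnp_pr_traces U (f : V -> {set V}) :
  gnp_pr p (fun G => [forall w in ~: U, nbrs G w :&: U == f w])
  = \prod_(w in ~: U) trace_wt U (f w).
Proof.
have [fU|] := boolP [forall w in ~: U, f w \subset U]; last first.
  rewrite negb_forall_in => /existsP[w /andP[wU fw]].
  rewrite /gnp_pr big1 => [|G /forall_inP/(_ w wU)/eqP E].
    by rewrite [RHS](bigD1 w) //= trace_wt_nsub // mul0r.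
  by move: fw; rewrite -E finset.subsetIr.
pose Q := finset.setX (~: U) U.
have QP z : z \in Q -> [/\ z.1 \notin U, z.2 \in U & z.1 != z.2].
  rewrite !inE => /andP[z1 z2]; split=> //.
  by apply: contraNneq z1 => ->.
have [e [eE einj]] : exists e : V * V -> option (vpair V),
  (forall z, z \in Q -> omap val (e z) = Some [set z.1; z.2]%SET) /\
  {in Q &, injective e}.
  have H z : z \in Q -> omap val (insub [set z.1; z.2]%SET : option (vpair V))
      = Some [set z.1; z.2]%SET.
    by move=> /QP[_ _ zz]; case: insubP => [? ? /= ->|] //; rewrite cards2 zz.
  exists (fun z => insub [set z.1; z.2]%SET); split=> // z z' zQ z'Q.
  move=> /(congr1 (omap val)); rewrite !H // => -[] E.
  have [z1 z2 _] := QP z zQ; have [z1' z2' _] := QP z' z'Q.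
  have e1 : z.1 \in [set z'.1; z'.2]%SET by rewrite -E !inE eqxx.
  have e2 : z.2 \in [set z'.1; z'.2]%SET by rewrite -E !inE eqxx orbT.
  rewrite [z]surjective_pairing [z']surjective_pairing.
  move: e1 e2; rewrite !inE => /orP[/eqP->|/eqP h]; last by rewrite h z2' in z1.
  by move=> /orP[/eqP h|/eqP-> //]; rewrite -h z2 in z1'.
(* [D] is the cut and [F] its part prescribed by [f]; the pairs in [Q] index the cut edges through
   [e]. *)
pose F := [set x | [exists z in Q, (e z == Some x) && (z.2 \in f z.1)]].
pose D := [set x | [exists z in Q, e z == Some x]].
have FD : F \subset D.
  apply/subsetP => x; rewrite !inE => /existsP[z /and3P[zQ ez _]].
  by apply/existsP; exists z; rewrite zQ ez.
have eF z x : z \in Q -> e z = Some x -> (x \in F) = (z.2 \in f z.1).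
  move=> zQ ez; rewrite inE; apply/existsP/idP => [[z' /and3P[z'Q /eqP ez']]|zf].
    by rewrite (einj z z') // ez ez'.
  by exists z; rewrite zQ ez eqxx.
have eD z x : z \in Q -> e z = Some x -> x \in D.
  by move=> zQ ez; rewrite inE; apply/existsP; exists z; rewrite zQ ez eqxx.
transitivity (gnp_pr p (fun G => G :&: D == F)).
  apply: eq_bigl => G /=; apply/forall_inP/eqP => [H|H w wU].
    apply/setP => x; apply/idP/idP.
      rewrite !inE => /andP[xG /existsP[z /andP[zQ /eqP ez]]].
      apply/existsP; exists z; rewrite zQ ez eqxx /=.
      have [z1 z2 _] := QP z zQ.
      have z1C : z.1 \in ~: U by rewrite inE.
      rewrite -(eqP (H _ z1C)) !inE z2 andbT.
      by rewrite (@adj_edge _ _ x) //; have := eE z zQ; rewrite ez => -[].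
    move=> xF; rewrite inE (subsetP FD) // andbT.
    move: xF; rewrite inE => /existsP[z /and3P[zQ /eqP ez zf]].
    have [z1 z2 _] := QP z zQ.
    have z1C : z.1 \in ~: U by rewrite inE.
    move: zf; rewrite -(eqP (H _ z1C)) !inE => /andP[az _].
    by rewrite -(@adj_edge _ _ x z.1 z.2) //; have := eE z zQ; rewrite ez => -[].
  apply/eqP/setP => u; rewrite !inE.
  have [uU|uU] := boolP (u \in U); last first.
    rewrite andbF; apply/esym; apply: contraNF uU.
    exact: (subsetP (forall_inP fU w wU)).
  have zQ : (w, u) \in Q by rewrite inE wU uU.
  have := eE _ zQ; case ez : (e _) => [x|] //= [vx].
  rewrite andbT (adj_edge _ vx) -(eF _ _ zQ ez) -H inE.
  by rewrite (eD _ _ zQ ez) andbT.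
rewrite gnp_pr_edges //.
under [RHS]eq_bigr => w wU do rewrite (trace_wt_sub (forall_inP fU w wU)).
rewrite [RHS]pair_big_dep /=.
have [D0|[x0 x0D]] := set_0Vmem D.
  rewrite D0 big_set0 big_pred0 // => -[w u] /=; apply/negP => /andP[wU uU].
  have zQ : (w, u) \in Q by rewrite inE wU uU.
  have := eE _ zQ; case ez : (e _) => [x|] //= _.
  by have := eD _ _ zQ ez; rewrite D0 inE.
have -> : D = [set odflt x0 (e z) | z in Q].
  apply/setP => x; rewrite inE; apply/existsP/imsetP => [[z /andP[zQ /eqP ez]]|].
    by exists z; rewrite ?ez.
  move=> [z zQ ->]; exists z; rewrite zQ /=.
  by have := eE z zQ; case: (e z).
rewrite big_imset /=; last first.
  move=> z z' zQ z'Q; have := eE z zQ; have := eE z' z'Q.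
  case ez: (e z) => [x|] //; case ez': (e z') => [x'|] //= _ _ xx'.
  by apply: einj; rewrite ?ez ?ez' ?xx'.
apply: eq_big => [[w u]|z zQ]; first by rewrite /= !inE.
by have := eE z zQ; case ez: (e z) => [x|] //= _; rewrite (eF z x).
Qed.

(* The traces N(w) :&: U, for w outside U, are determined by disjoint sets of
   edges, hence independent. *)
Lemma gnp_mean_traces U (h : V -> {set V} -> R) :
  gnp_mean (fun G => \prod_(w in ~: U) h w (nbrs G w :&: U))
  = \prod_(w in ~: U) \sum_S trace_wt U S * h w S.
Proof.
rewrite (big_distr_big_dep finset.set0) /=.
(* Expansion over all families [f] of traces; the indicators select the family that [G] realizes. *)
transitivity (\sum_G \sum_(f in pfamily finset.set0 (mem (~: U)) (fun=> predT))
    gnp_pmf p G * ((\prod_(w in ~: U) h w (f w)) *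
    \prod_(w in ~: U) (nbrs G w :&: U == f w)%:R)).
  apply: eq_bigr => G _; rewrite -big_distrr /=; congr (_ * _).
  under [RHS]eq_bigr => f _ do rewrite -big_split /=.
  rewrite -(big_distr_big_dep finset.set0 _ _ (fun w S => h w S * (_ == S)%:R)).
  apply: eq_bigr => w _; rewrite (bigD1 (nbrs G w :&: U)) //= eqxx mulr1.
  by rewrite big1 ?addr0 // => S /negbTE; rewrite eq_sym => ->; rewrite mulr0.
rewrite exchange_big /=; apply: eq_bigr => f _.
rewrite big_split /= -gnp_pr_traces mulrC /gnp_pr [X in _ = _ * X]big_mkcond.
rewrite big_distrr /=.
apply: eq_bigr => G _; rewrite mulrCA; congr (_ * _).
case: ifPn => [/forall_inP H|].
  by rewrite big1 ?mulr1 // => w /H /eqP ->; rewrite eqxx.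
rewrite negb_forall_in => /existsP[w /andP[wU /negbTE h0]].
by rewrite [X in _ * X](bigD1 w) //= h0 mul0r mulr0.
Qed.

(** The vertices of [U] enter a trace independently, so a product over vertices is averaged factor
    by factor; those outside [U] never belong to it and contribute [b]. *)
Lemma trace_wt_prod U (a b : V -> R) :
  \sum_S trace_wt U S * \prod_u (if u \in S then a u else b u)
  = \prod_u (if u \in U then p * a u + (1 - p) * b u else b u).
Proof.
transitivity (\prod_u ((if u \in U then p * a u else 0) +
                       (if u \in U then (1 - p) * b u else b u))).
  rewrite bigA_distr; apply: eq_bigr => S _; rewrite /trace_wt -big_split /=.
  apply: eq_bigr => u _; case: (u \in S); case: (u \in U) => //.
    by rewrite mul0r.
  by rewrite mul1r.
by apply: eq_bigr => u _; case: ifP => _; rewrite ?add0r.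
Qed.

Lemma trace_wt_sum U (A B : {set V}) : A \subset U -> B \subset U -> [disjoint A & B] ->
  \sum_(S : {set V} | (A \subset S) && [disjoint S & B]) trace_wt U S
  = p ^+ #|A| * (1 - p) ^+ #|B|.
Proof.
move=> AU BU AB.
transitivity (\sum_S trace_wt U S *
    \prod_u (if u \in S then (u \notin B)%:R else (u \notin A)%:R)).
  rewrite big_mkcond; apply: eq_bigr => S _; case: ifPn => [/andP[AS SB]|].
    rewrite big1 ?mulr1 // => u _; case: ifPn => uS.
      by rewrite (disjointFr SB uS).
    by rewrite (contra (subsetP AS u) uS).
  move=> H; suff -> : \prod_u (if u \in S then (u \notin B)%:R
     else (u \notin A)%:R : R) = 0 by rewrite mulr0.
  apply/eqP/prodf_eq0; move: H; rewrite negb_and => /orP[/subsetPn[u uA uS]|].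
    by exists u => //; rewrite (negbTE uS) uA.
  rewrite -setI_eq0 => /set0Pn[u]; rewrite inE => /andP[uS uB].
  by exists u => //; rewrite uS uB.
rewrite trace_wt_prod -!prodr_const.
rewrite [X in _ = X * _]big_mkcond [X in _ = _ * X]big_mkcond -big_split /=.
apply: eq_bigr => u _.
have [uA|uA] := boolP (u \in A).
  by rewrite (subsetP AU) // (disjointFr AB uA) /=; ring.
have [uB|uB] := boolP (u \in B); first by rewrite (subsetP BU) //=; ring.
by case: ifP => _ /=; ring.
Qed.

Lemma trace_wt_total U : \sum_S trace_wt U S = 1.
Proof.
have := @trace_wt_sum U finset.set0 finset.set0.
rewrite !finset.sub0set !cards0 !expr0 mulr1 => <- //; last first.
  by rewrite -setI_eq0 finset.setI0.
by apply: eq_bigl => S; rewrite finset.sub0set -setI_eq0 finset.setI0 eqxx.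
Qed.

Hypothesis p01 : 0 <= p <= 1.

Lemma gnp_pmf_ge0 G : 0 <= gnp_pmf p G.
Proof.
by apply: prodr_ge0 => e _; case: ifP => _; case/andP: p01; rewrite ?subr_ge0.
Qed.

Lemma trace_wt_ge0 U S : 0 <= trace_wt U S.
Proof.
apply: prodr_ge0 => u _; case/andP: p01 => p0 p1.
by do 2!case: ifP => _ //; rewrite ?subr_ge0.
Qed.

(** The form of Markov's inequality behind the tail bounds: [f] dominates the indicator of [A]. *)
Lemma gnp_pr_le_mean (A : pred (graph V)) (f : graph V -> R) :
  (forall G, 0 <= f G) -> (forall G, A G -> 1 <= f G) ->
  gnp_pr p A <= gnp_mean f.
Proof.
move=> f0 f1; rewrite /gnp_pr big_mkcond; apply: ler_sum => G _.
case: ifP => AG; last by rewrite mulr_ge0 ?gnp_pmf_ge0.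
by rewrite ler_peMr ?gnp_pmf_ge0 ?f1.
Qed.

Lemma gnp_pr_sub (A B : pred (graph V)) : subpred A B ->
  gnp_pr p A <= gnp_pr p B.
Proof.
move=> AB; rewrite /gnp_pr [leLHS]big_mkcond [leRHS]big_mkcond.
apply: ler_sum => G _; case: ifP => [/AB -> //|_].
by case: ifP => _ //; apply: gnp_pmf_ge0.
Qed.

Lemma gnp_prC (A : pred (graph V)) : gnp_pr p (predC A) = 1 - gnp_pr p A.
Proof.
rewrite -(@gnp_pr_total R n p) /gnp_pr [X in X - _](bigID A) /=.
by rewrite addrAC subrr add0r.
Qed.

Lemma gnp_pr_le1 (A : pred (graph V)) : gnp_pr p A <= 1.
Proof. by rewrite -(@gnp_pr_total R n p); apply: gnp_pr_sub. Qed.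

Lemma gnp_pr_exists (I : finType) (P : pred I) (B : I -> pred (graph V)) :
  gnp_pr p (fun G => [exists i, P i && B i G])
  <= \sum_(i | P i) gnp_pr p (B i).
Proof.
apply: (@le_trans _ _ (gnp_mean (fun G => \sum_(i | P i) (B i G)%:R))).
  apply: gnp_pr_le_mean => [G|G /existsP[i /andP[Pi Bi]]].
    by apply: sumr_ge0 => i _; rewrite ler0n.
  rewrite (bigD1 i) //= Bi lerDl.
  by apply: sumr_ge0 => j _; rewrite ler0n.
rewrite /gnp_mean le_eqVlt; apply/orP; left; apply/eqP.
under eq_bigr => G _ do rewrite big_distrr /=.
rewrite exchange_big /=; apply: eq_bigr => i _.
rewrite /gnp_pr [RHS]big_mkcond; apply: eq_bigr => G _.
by case: ifP => _; rewrite ?mulr1 ?mulr0.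
Qed.

Lemma gnp_pr_or (A B : pred (graph V)) :
  gnp_pr p (fun G => A G || B G) <= gnp_pr p A + gnp_pr p B.
Proof.
have := @gnp_pr_exists bool predT (fun b => if b then A else B).
rewrite big_bool /=; apply: le_trans; apply: gnp_pr_sub => G /orP[h|h].
  by apply/existsP; exists true.
by apply/existsP; exists false.
Qed.

End Gnp.

(** * Tail bounds *)

Section Tails.
Variables (R : realType) (n : nat) (p : R).
Hypothesis p01 : 0 <= p <= 1.
Local Notation V := 'I_n.
Implicit Types (G : graph V) (U W S : {set V}).

(** Only [w] outside [U] are counted, so that the traces involve disjoint sets of edges: the count
    is binomial with success probability [trace_pr U P]. *)
Definition trace_count U (P : pred {set V}) G : nat :=
  #|[set w in ~: U | P (nbrs G w :&: U)]|.

Definition trace_pr U (P : pred {set V}) : R := \sum_(S | P S) trace_wt p U S.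

(** Chernoff's method: by independence the exponential moment is a product, whose factors are
    bounded through [1 + x <= exp x]. A positive [s] gives upper tails, a negative one lower
    tails. *)
Lemma gnp_trace_count_tail U P (s a : R) :
  gnp_pr p (fun G => a <= s * (trace_count U P G)%:R)
  <= expR (#|~: U|%:R * trace_pr U P * (expR s - 1) - a).
Proof.
pose h (_ : V) S : R := expR (s * (P S)%:R).
have hE G : \prod_(w in ~: U) h w (nbrs G w :&: U)
    = expR (s * (trace_count U P G)%:R).
  rewrite -expR_sum -big_distrr /= /trace_count -sum1_card natr_sum.
  rewrite big_mkcond [in RHS]big_mkcond; congr (expR (_ * _)).
  by apply: eq_bigr => w _; rewrite !inE; case: (w \in U) => //=; case: ifP.
apply: (@le_trans _ _ (gnp_mean p (fun G => expR (- a) *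
    \prod_(w in ~: U) h w (nbrs G w :&: U)))).
  apply: gnp_pr_le_mean => // [G|G aX]; first by rewrite hE mulr_ge0 ?expR_ge0.
  by rewrite hE -expRD -[leLHS]expR0 ler_expR addrC subr_ge0.
have -> : gnp_mean p (fun G => expR (- a) *
    \prod_(w in ~: U) h w (nbrs G w :&: U)) =
   expR (- a) * gnp_mean p (fun G => \prod_(w in ~: U) h w (nbrs G w :&: U)).
  by rewrite /gnp_mean big_distrr; apply: eq_bigr => G _; rewrite mulrCA.
rewrite gnp_mean_traces expRD [leRHS]mulrC ler_pM2l ?expR_gt0 //.
rewrite /h prodr_const -mulrA expRM_natl lerXn2r ?nnegrE ?expR_ge0 //.
  by apply: sumr_ge0 => S _; rewrite mulr_ge0 ?expR_ge0 ?trace_wt_ge0.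
apply: le_trans (expR_ge1Dx _); rewrite /trace_pr.
rewrite -{2}(trace_wt_total p U) big_distrl /= [X in _ + X]big_mkcond -big_split /=.
apply: ler_sum => S _; case: (P S).
  by rewrite mulr1 mulrBr mulr1 addrC subrK.
by rewrite mulr0 expR0 mulr1 addr0.
Qed.

Lemma gnp_trace_count_eq0 U P :
  gnp_pr p (fun G => trace_count U P G == 0%N)
  <= expR (- (#|~: U|%:R * trace_pr U P)).
Proof.
pose h (_ : V) S : R := (~~ P S)%:R.
apply: (@le_trans _ _ (gnp_mean p (fun G =>
    \prod_(w in ~: U) h w (nbrs G w :&: U)))).
  apply: gnp_pr_le_mean => // [G|G]; first by apply: prodr_ge0 => w _; rewrite ler0n.
  rewrite cards_eq0 => /eqP X0; rewrite big1 // => w wU.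
  have := in_set0 w; rewrite -X0 inE wU /h /=; by case: (P _).
rewrite gnp_mean_traces /h prodr_const -mulrN expRM_natl.
rewrite lerXn2r ?nnegrE ?expR_ge0 //.
  by apply: sumr_ge0 => S _; rewrite mulr_ge0 ?ler0n ?trace_wt_ge0.
apply: le_trans (expR_ge1Dx _); rewrite /trace_pr.
rewrite -[X in X - _](trace_wt_total p U) -sumrN [X in _ + X]big_mkcond -big_split /=.
by apply: ler_sum => S _; case: (P S); rewrite ?mulr0 ?mulr1 ?addr0 ?subrr.
Qed.

Lemma card_setC U : #|~: U|%:R = n%:R - #|U|%:R :> R.
Proof. by rewrite -[in n%:R](card_ord n) -(cardsC U) natrD addrAC subrr add0r. Qed.

Lemma gnp_degree_tail :
  gnp_pr p (fun G => [exists v, ~~ (#|nbrs G v|%:R <= 4 * n%:R * p)])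
  <= n%:R * expR (- (n%:R * p)).
Proof.
apply: (le_trans (gnp_pr_exists p01 predT _)).
have -> : n%:R * expR (- (n%:R * p)) = \sum_(v : V) expR (- (n%:R * p)).
  by rewrite sumr_const card_ord mulr_natl.
apply: ler_sum => v _.
pose P S := v \in S.
have degE G : #|nbrs G v| = trace_count [set v] P G.
  rewrite /trace_count /P; apply: eq_card => w; rewrite !inE eqxx andbT.
  by rewrite adj_sym; case: eqP => // ->; rewrite adj_irr.
have PE : trace_pr [set v] P = p.
  have := @trace_wt_sum _ n p [set v]%SET [set v]%SET finset.set0.
  rewrite cards1 cards0 expr1 expr0 mulr1 => <- //.
  - by apply: eq_bigl => S; rewrite finset.sub1set -setI_eq0 finset.setI0 eqxx andbT.
  - by rewrite finset.sub0set.
  by rewrite -setI_eq0 finset.setI0.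
apply: (le_trans (gnp_pr_sub p01 _)); last first.
  (* With [s = 1/2] and [exp (1/2) <= 2] the exponent is at most [n p - 2 n p]. *)
  apply: le_trans (gnp_trace_count_tail [set v]%SET P (2^-1) (2 * n%:R * p)) _.
  rewrite ler_expR card_setC PE cards1.
  have e2 : expR (2^-1) <= 2 :> R.
    have := expR_ge1Dx (- 2^-1 : R); rewrite expRN => H.
    rewrite -lef_pV2 ?posrE ?expR_gt0 //; apply: le_trans H; lra.
  case/andP: p01 => p0 p1; have n1 : 1 <= n%:R :> R.
    by rewrite ler1n (leq_ltn_trans (leq0n v)).
  have h : expR 2^-1 - 1 <= 1 :> R by lra.
  have h' : (n%:R - 1) * p * (expR 2^-1 - 1) <= (n%:R - 1) * p * 1.
    by apply: ler_wpM2l => //; rewrite mulr_ge0 // subr_ge0.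
  by move: h'; nra.
by move=> G /=; rewrite degE -ltNge => H; lra.
Qed.

Lemma trace_pr_in2 (x y : V) : x != y ->
  trace_pr [set x; y] (fun S => (x \in S) && (y \in S)) = p ^+ 2.
Proof.
move=> xy; have := @trace_wt_sum _ n p [set x; y]%SET [set x; y]%SET finset.set0.
rewrite cards2 xy cards0 expr0 mulr1 => <- //; last 2 first.
- by rewrite finset.sub0set.
- by rewrite -setI_eq0 finset.setI0.
apply: eq_bigl => S; rewrite finset.subUset !finset.sub1set.
by rewrite -setI_eq0 finset.setI0 eqxx andbT.
Qed.

Lemma trace_pr_xor (x y : V) : x != y ->
  trace_pr [set x; y] (fun S => (x \in S) != (y \in S)) = 2 * p * (1 - p).
Proof.
have H (a b : V) : a != b -> \sum_(S : {set V} | (a \in S) && (b \notin S))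
   trace_wt p [set a; b] S = p * (1 - p).
  move=> ab; have := @trace_wt_sum _ n p [set a; b]%SET [set a]%SET [set b]%SET.
  rewrite !cards1 !expr1 => <-.
  - by apply: eq_bigl => S; rewrite finset.sub1set disjoint_sym disjoints1.
  - by rewrite finset.sub1set !inE eqxx.
  - by rewrite finset.sub1set !inE eqxx orbT.
  - by rewrite disjoints1 !inE.
move=> xy; rewrite /trace_pr (bigID (fun S : {set V} => x \in S)) /=.
have -> : 2 * p * (1 - p) = p * (1 - p) + p * (1 - p) by ring.
congr (_ + _).
  by rewrite -(H x y) //; apply: eq_bigl => S; case: (x \in S); case: (y \in S).
rewrite -(H y x) 1?eq_sym // finset.setUC.
by apply: eq_bigl => S; case: (x \in S); case: (y \in S).
Qed.

Lemma sum_pairs_const (a : R) : \sum_(xy : V * V) a = n%:R ^+ 2 * a.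
Proof. by rewrite sumr_const card_prod card_ord -natrX expnS expn1 mulr_natl. Qed.

(** A vertex adjacent to exactly one of [x], [y] separates them; the number of these is binomial
    with mean [(n - 2) 2 p (1 - p)], and the Chernoff bound is used with [s = - d / 2]. *)
Lemma gnp_separation_tail (d : R) : 0 <= d <= 1 ->
  gnp_pr p (fun G => [exists xy : V * V, (xy.1 != xy.2) &&
    ((trace_count [set xy.1; xy.2] (fun S => (xy.1 \in S) != (xy.2 \in S)) G)%:R
     <= (1 - d) * ((n%:R - 2) * (2 * p * (1 - p))))])
  <= n%:R ^+ 2 * expR (- ((n%:R - 2) * (2 * p * (1 - p)) * d ^+ 2 / 4)).
Proof.
move=> /andP[d0 d1]; apply: (le_trans (gnp_pr_exists p01 _ _)).
rewrite -sum_pairs_const big_mkcond; apply: ler_sum => -[x y] _ /=; case: ifP; last first.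
  by rewrite expR_ge0.
move=> xy; set P := (fun S : {set V} => _); set M := (n%:R - 2) * _.
apply: (le_trans (gnp_pr_sub p01 _)); last first.
  apply: le_trans (gnp_trace_count_tail [set x; y]%SET P (- (d / 2))
     (- (d / 2) * ((1 - d) * M))) _.
  rewrite ler_expR card_setC cards2 xy trace_pr_xor // -/M.
  have M0 : 0 <= M.
    case/andP: p01 => p0 p1; rewrite /M !mulr_ge0 ?subr_ge0 //.
    rewrite -[X in X%:R <= _](_ : #|[set x; y]%SET| = 2%N); last by rewrite cards2 xy.
    by rewrite -[X in _ <= X%:R](card_ord n) ler_nat max_card.
  (* From [(1 + x) (1 - x + x ^ 2) = 1 + x ^ 3 >= 1] with [x = d / 2]. *)
  have e1 : expR (- (d / 2)) <= 1 - d / 2 + (d / 2) ^+ 2.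
    have w : 0 < 1 - d / 2 + (d / 2) ^+ 2 by have := sqr_ge0 (d / 2); lra.
    rewrite expRN -[leRHS]invrK lef_pV2 ?posrE ?expR_gt0 ?invr_gt0 //.
    apply: le_trans (expR_ge1Dx _).
    have h : 0 <= (d / 2) ^+ 3 by rewrite exprn_ge0 ?divr_ge0.
    by rewrite -[leLHS]mul1r ler_pdivrMr //; lra.
  have h : M * (expR (- (d / 2)) - 1) <= M * (- (d / 2) + (d / 2) ^+ 2).
    by apply: ler_wpM2l => //; lra.
  have -> : - (M * d ^+ 2 / 4) = M * (- (d / 2) + (d / 2) ^+ 2)
     - - (d / 2) * ((1 - d) * M) by field.
  by rewrite lerD2r.
by move=> G /= H; rewrite !mulNr lerN2 ler_wpM2l // divr_ge0.
Qed.

(** Off this event any two vertices have a common neighbour, so the diameter is at most 2. *)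
Lemma gnp_diameter_tail :
  gnp_pr p (fun G => [exists xy : V * V, (xy.1 != xy.2) &&
    (trace_count [set xy.1; xy.2] (fun S => (xy.1 \in S) && (xy.2 \in S)) G == 0)%N])
  <= n%:R ^+ 2 * expR (- ((n%:R - 2) * p ^+ 2)).
Proof.
apply: (le_trans (gnp_pr_exists p01 _ _)).
rewrite -sum_pairs_const big_mkcond; apply: ler_sum => -[x y] _ /=; case: ifP; last first.
  by rewrite expR_ge0.
move=> xy; apply: le_trans (gnp_trace_count_eq0 _ _) _.
by rewrite ler_expR card_setC cards2 xy trace_pr_in2.
Qed.

(* Give W the weight n ^ (K - #|W|), which is at least 1 when #|W| <= K; the
   weights add up to n ^ K * (1 + 1 / n) ^ n. *)
Lemma card_small_sets (K : R) : (0 < n)%N ->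
  \sum_(W : {set V} | #|W|%:R <= K) 1 <= expR (1 + K * ln n%:R) :> R.
Proof.
move=> n0; have n0' : 0 < n%:R :> R by rewrite ltr0n.
have n1 : 0 <= ln n%:R :> R by rewrite ln_ge0 // ler1n.
rewrite expRD mulrC.
apply: (@le_trans _ _ (\sum_(W : {set V}) expR (K * ln n%:R) * n%:R ^- #|W|)).
  rewrite big_mkcond; apply: ler_sum => W _; case: ifP => WK; last first.
    by rewrite mulr_ge0 ?expR_ge0 // invr_ge0 exprn_ge0.
  rewrite ler_pdivlMr ?exprn_gt0 // mul1r -[X in X ^+ _]lnK ?posrE //.
  by rewrite -expRM_natl ler_expR ler_wpM2r.
rewrite -big_distrr /= ler_wpM2l ?expR_ge0 //.
have -> : \sum_(W : {set V}) n%:R ^- #|W| = \prod_(i : V) (n%:R^-1 + 1) :> R.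
  rewrite bigA_distr; apply: eq_bigr => W _.
  by rewrite -big_mkcond /= prodr_const exprVn.
rewrite prodr_const card_ord -[X in expR X](mulfV (lt0r_neq0 n0')) expRM_natl.
by rewrite lerXn2r ?nnegrE ?expR_ge0 ?addr_ge0 ?invr_ge0 ?ler01 // addrC expR_ge1Dx.
Qed.

End Tails.

(** * The extension property *)

Section Extension.
Variables (R : realType) (n : nat) (p : R).
Hypothesis p01 : 0 <= p <= 1.
Local Notation V := 'I_n.
Implicit Types (G : graph V) (U W S : {set V}).

(** Off this event, every [S] inside a set [B] of at most [b] vertices is the exact neighbourhood in
    [B] of some vertex outside [B]. A given trace has probability at least [mu ^ b]; the factor 2
    comes from summing over both [B] and [S]. *)
Lemma gnp_extension_tail (b : nat) (mu : R) : (0 < n)%N ->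
  0 <= mu -> mu <= p -> mu <= 1 - p -> (b <= n)%N ->
  gnp_pr p (fun G => [exists BS : {set V} * {set V},
      [&& (#|BS.1| <= b)%N, (#|BS.2| <= b)%N & BS.2 \subset BS.1] &&
      (trace_count BS.1 (pred1 BS.2) G == 0%N)])
  <= expR (2 * (1 + b%:R * ln n%:R) - (n - b)%:R * mu ^+ b).
Proof.
move=> n0 mu0 mup muq bn.
apply: (le_trans (gnp_pr_exists p01 _ _)).
apply: (@le_trans _ _ (\sum_(BS : {set V} * {set V} |
   (#|BS.1|%:R <= b%:R :> R) && (#|BS.2|%:R <= b%:R :> R)) expR (- ((n - b)%:R * mu ^+ b)))).
  rewrite big_mkcond [leRHS]big_mkcond; apply: ler_sum => -[B S] _ /=.
  rewrite !ler_nat; case: ifP => [/and3P[Bb Sb SB]|]; last first.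
    by case: ifP => _ //; rewrite expR_ge0.
  rewrite Bb Sb /=; apply: le_trans (gnp_trace_count_eq0 p01 _ _) _.
  rewrite ler_expR lerN2; apply: ler_pM => //; rewrite ?exprn_ge0 ?ler0n //.
    by rewrite ler_nat leq_subLR -[leqLHS](card_ord n) -(cardsC B) leq_add2r.
  rewrite /trace_pr big_pred1_eq trace_wt_sub //.
  apply: (@le_trans _ _ (mu ^+ #|B|)).
    by apply: ler_wiXn2l => //; apply: le_trans mup _; case/andP: p01.
  rewrite -prodr_const; apply: ler_prod => u _; rewrite mu0 /=.
  by case: ifP.
rewrite -(pair_big (fun B : {set V} => #|B|%:R <= b%:R :> R)
   (fun B : {set V} => #|B|%:R <= b%:R :> R) (fun _ _ => expR _)) /=.
set e := expR (- _).
have H := @card_small_sets R n b%:R n0.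
have -> : \sum_(i : {set V} | #|i|%:R <= b%:R :> R) \sum_(j : {set V} | #|j|%:R <= b%:R :> R) e =
   (\sum_(i : {set V} | #|i|%:R <= b%:R :> R) 1) ^+ 2 * e.
  rewrite expr2 -mulrA big_distrl /=; apply: eq_bigr => i _.
  by rewrite mul1r big_distrl /=; apply: eq_bigr => j _; rewrite mul1r.
rewrite expRD ler_wpM2r ?expR_ge0 // mulrC -[2]/(2%:R) expRM_natr.
by rewrite lerXn2r ?nnegrE ?expR_ge0 // sumr_ge0.
Qed.

End Extension.

Lemma ex_subset_card (T : finType) (X : {set T}) (m : nat) : (m <= #|X|)%N ->
  exists2 A : {set T}, A \subset X & #|A| = m.
Proof.
move=> mX; exists [set x in take m (enum X)].
  by apply/subsetP => x; rewrite inE => /mem_take; rewrite mem_enum.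
rewrite cardsE (card_uniqP _) ?take_uniq ?enum_uniq //.
by rewrite size_take_min -cardE; apply/minn_idPl.
Qed.

(** * Neighbours of a vertex with equal traces *)

Section Twins.
Variables (R : realType) (n : nat) (p : R).
Hypothesis p01 : 0 <= p <= 1.
Local Notation V := 'I_n.
Implicit Types (G : graph V) (U W S : {set V}).

(** Meant for [v \in U]: then equal traces make [y] a neighbour of [v] along with [x]. *)
Definition twin_free (v : V) U G : bool :=
  [forall x in ~: U, forall y in ~: U,
    (v \in nbrs G x) && (nbrs G x :&: U == nbrs G y :&: U) ==> (x == y)].

(** The probability that two independent traces coincide and contain [v]: the vertex [v] gives
    [p ^ 2], every other one of [U] gives [rho p]. *)
Lemma trace_wt_sqr (v : V) U : v \in U ->
  \sum_(S : {set V} | v \in S) trace_wt p U S ^+ 2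
  = p ^+ 2 * rho p ^+ #|U|.-1.
Proof.
move=> vU; rewrite (cardsD1 v U) vU /= -prodr_const.
transitivity (\prod_u ((if u \in U then p ^+ 2 else 0) +
   (if u == v then 0 else if u \in U then (1 - p) ^+ 2 else 1))).
  rewrite bigA_distr big_mkcond; apply: eq_bigr => S _.
  case: ifPn => vS; last first.
    by rewrite [RHS](bigD1 v) //= (negbTE vS) eqxx mul0r.
  rewrite /trace_wt -prodrXl; apply: eq_bigr => u _.
  case: (boolP (u \in S)) => uS; first by case: ifP; rewrite ?expr0n.
  rewrite [in RHS]ifN; last by apply: contraNneq uS => ->.
  by case: ifP; rewrite ?expr1n.
rewrite (bigD1 v) //= vU eqxx addr0; congr (_ * _).
rewrite big_mkcond [RHS]big_mkcond; apply: eq_bigr => u _.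
rewrite !inE; case: eqP => //= _; case: ifP => _ //.
by rewrite add0r.
Qed.

Lemma expR_le_frac (y : R) : 0 <= y -> expR (- y) <= 1 - y / (1 + y).
Proof.
move=> y0; have -> : 1 - y / (1 + y) = (1 + y)^-1 by field; lra.
by rewrite expRN lef_pV2 ?posrE ?expR_gt0 ?expR_ge1Dx //; lra.
Qed.

(* A birthday bound. Choose disjoint A, B of size m outside U and fix the traces f
   on A: if no trace repeats, those on B avoid a set of mass
   sum_(i in A) g (f i), which has probability at most
   prod_(i in A) exp (- m g (f i)). Summing over f gives a product again. *)
Lemma gnp_twin_free (v : V) U (m : nat) : v \in U -> (m.*2 <= #|~: U|)%N ->
  gnp_pr p (twin_free v U) <=
  expR (- ((m%:R * (p * Num.sqrt (rho p ^+ #|U|.-1))) ^+ 2 /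
           (1 + m%:R * (p * Num.sqrt (rho p ^+ #|U|.-1))))).
Proof.
move=> vU mU; set L : R := p * Num.sqrt _; set z : R := m%:R * L.
have [A AU Am] : exists2 A : {set V}, A \subset ~: U & #|A| = m.
  by apply: ex_subset_card; apply: leq_trans mU; rewrite -addnn leq_addr.
have [B BU Bm] : exists2 B : {set V}, B \subset ~: U :\: A & #|B| = m.
  by apply: ex_subset_card; rewrite (cardsDS AU) Am; move: mU; lia.
have BU' : B \subset ~: U.
  by apply: fintype.subset_trans BU (finset.subsetDl _ _).
have AB w : w \in B -> w \notin A.
  by move=> /(subsetP BU); rewrite inE => /andP[].
pose fam := pfamily finset.set0 (mem A) (fun _ : V => @predT {set V}).
pose A' (f : {ffun V -> {set V}}) := [set i in A | v \in f i].
(* Given traces [f] on [A], what is allowed at [w]: only [f w] on [A], no repetition of a trace from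
   [A] containing [v] on [B], anything elsewhere. *)
pose h (f : {ffun V -> {set V}}) (w : V) S : bool :=
  if w \in A then S == f w
  else if w \in B then ~~ ((v \in S) && (S \in [set f i | i in A])) else true.
have tf G : twin_free v U G -> [exists f : {ffun V -> {set V}},
   [&& f \in fam & [forall x in A' f, forall y in A' f, (f x == f y) ==> (x == y)]] &&
   [forall w in ~: U, h f w (nbrs G w :&: U)]].
  move=> /forall_inP tfG; pose f := [ffun w => if w \in A then nbrs G w :&: U else finset.set0].
  have fA w : w \in A -> f w = nbrs G w :&: U by rewrite ffunE => ->.
  have tw x y : x \in ~: U -> y \in ~: U -> v \in nbrs G x ->
      nbrs G x :&: U = nbrs G y :&: U -> x = y.
    move=> xU yU vx e; apply/eqP; have /forall_inP/(_ y yU) := tfG x xU.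
    by rewrite vx e eqxx.
  apply/existsP; exists f; apply/andP; split; first (apply/andP; split).
  - apply/pfamilyP; split=> // ; apply/supportP => w wA.
    by rewrite ffunE (negbTE wA).
  - apply/forall_inP => x; rewrite inE => /andP[xA].
    rewrite (fA x xA) inE => /andP[vx _].
    apply/forall_inP => y; rewrite inE => /andP[yA _].
    apply/implyP; rewrite !fA // => /eqP e; apply/eqP.
    by apply: tw e => //; apply: (subsetP AU).
  apply/forall_inP => w wU; rewrite /h; case: ifPn => wA; first by rewrite fA.
  case: ifPn => // wB; apply/negP => /andP[vw /imsetP[i iA]].
  rewrite fA // => e; move: wA.
  rewrite (_ : w = i) ?iA //; apply: tw e => //; first exact: (subsetP AU).
  by move: vw; rewrite inE => /andP[].
apply: (le_trans (gnp_pr_sub p01 tf)).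
apply: (le_trans (gnp_pr_exists p01 _ _)).
pose g (S : {set V}) : R := if v \in S then trace_wt p U S else 0.
have bound f : f \in fam ->
    [forall x in A' f, forall y in A' f, (f x == f y) ==> (x == y)] ->
    gnp_pr p (fun G => [forall w in ~: U, h f w (nbrs G w :&: U)])
    <= \prod_(i in A) (trace_wt p U (f i) * expR (- (m%:R * g (f i)))).
  move=> fam_f /forall_inP finj.
  apply: (@le_trans _ _ (gnp_mean p (fun G =>
      \prod_(w in ~: U) (h f w (nbrs G w :&: U))%:R))).
    apply: gnp_pr_le_mean => // [G|G /forall_inP H].
      by apply: prodr_ge0 => w _; rewrite ler0n.
    by rewrite big1 // => w /H ->.
  rewrite (gnp_mean_traces p U (fun w S => (h f w S)%:R)).
  pose mass := \sum_(i in A) g (f i).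
  (* Without repetitions among the [f i] containing [v], the mass of the forbidden traces is the sum
     over [A]. *)
  have massE : \sum_(S : {set V} | (v \in S) && (S \in [set f i | i in A])) trace_wt p U S = mass.
    rewrite /mass /g -big_mkcondr /=.
    rewrite (eq_bigl (fun i => i \in A' f)); last by move=> i; rewrite [RHS]inE.
    rewrite -[RHS](big_imset (trace_wt p U)) /=; last first.
      move=> x y xA yA e; have /forall_inP/(_ y yA)/implyP := finj x xA.
      by rewrite e eqxx => /(_ isT)/eqP.
    apply: eq_bigl => S; apply/andP/imsetP => [[vS /imsetP[i iA e]]|[i]].
      by exists i => //; rewrite inE iA -e.
    by rewrite inE => /andP[iA vi] ->; split=> //; apply/imsetP; exists i.
  have FE w : w \in ~: U -> \sum_S trace_wt p U S * (h f w S)%:R =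
     (if w \in A then trace_wt p U (f w) else 1) *
     (if w \in B then 1 - mass else 1).
    move=> wU; rewrite /h; case: (boolP (w \in A)) => wA.
      rewrite ifN ?mulr1; last by apply: contraTN wA => /AB.
      rewrite (bigD1 (f w)) //= eqxx mulr1 big1 ?addr0 // => S /negbTE ->.
      by rewrite mulr0.
    rewrite mul1r; case: (boolP (w \in B)) => wB; last first.
      by rewrite -[RHS](trace_wt_total p U); apply: eq_bigr => S _; apply: mulr1.
    rewrite -massE -[X in X - _](trace_wt_total p U).
    rewrite [X in _ - X]big_mkcond -sumrB; apply: eq_bigr => S _.
    by case: (_ && _); rewrite ?mulr0 ?mulr1 ?subrr ?subr0.
  rewrite (eq_bigr _ FE) big_split /= -!big_mkcondr /=.
  rewrite (eq_bigl (fun w => w \in A)); last first.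
    move=> w /=; apply/andP/idP => [[]//|wA]; split=> //; exact: (subsetP AU).
  rewrite [X in _ * X](eq_bigl (fun w => w \in B)); last first.
    move=> w /=; apply/andP/idP => [[]//|wB]; split=> //; exact: (subsetP BU').
  rewrite prodr_const Bm big_split /= ler_wpM2l //.
    by apply: prodr_ge0 => i _; apply: trace_wt_ge0.
  rewrite -expR_sum sumrN -mulr_sumr -/mass -mulrN expRM_natl.
  rewrite lerXn2r ?nnegrE ?expR_ge0 ?expR_ge1Dx //.
  rewrite subr_ge0 -massE -(trace_wt_total p U) [leRHS](bigID (fun S : {set V} =>
     (v \in S) && (S \in [set f i | i in A]))) /= lerDl.
  by apply: sumr_ge0 => S _; apply: trace_wt_ge0.
apply: (@le_trans _ _ (\sum_(f in fam)
    \prod_(i in A) (trace_wt p U (f i) * expR (- (m%:R * g (f i)))))).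
  rewrite [leLHS]big_mkcond [leRHS]big_mkcond; apply: ler_sum => f _ /=.
  have pos : 0 <= \prod_(i in A) (trace_wt p U (f i) * expR (- (m%:R * g (f i)))).
    by apply: prodr_ge0 => i _; rewrite mulr_ge0 ?expR_ge0 ?trace_wt_ge0.
  case: ifP => [/andP[ff fi]|_]; first by rewrite ff bound.
  by case: ifP.
rewrite /fam -(big_distr_big_dep finset.set0 (mem A) (fun _ => predT)
  (fun _ S => trace_wt p U S * expR (- (m%:R * g S)))) /= prodr_const Am.
have zm0 : m = 0%N -> z = 0 by move=> m0; rewrite /z m0 mul0r.
(* The exponent is shared equally among the [m] identical factors. *)
have -> : - (z ^+ 2 / (1 + z)) = m%:R * - (z ^+ 2 / (1 + z) / m%:R).
  have [m0|m0] := eqVneq m 0%N; last by rewrite mulrN mulrCA mulfV ?mulr1 ?pnatr_eq0.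
  by rewrite zm0 // m0 expr0n /= !mul0r oppr0.
rewrite expRM_natl lerXn2r ?nnegrE ?expR_ge0 //.
  by apply: sumr_ge0 => S _; rewrite mulr_ge0 ?expR_ge0 ?trace_wt_ge0.
apply: le_trans (expR_ge1Dx _).
have rho0 : 0 <= rho p by rewrite /rho addr_ge0 ?sqr_ge0.
have L0 : 0 <= L by rewrite /L mulr_ge0 ?sqrtr_ge0 //; case/andP: p01.
have L2 : L ^+ 2 = \sum_(S : {set V} | v \in S) trace_wt p U S ^+ 2.
  by rewrite trace_wt_sqr // /L exprMn sqr_sqrtr // exprn_ge0.
have z0 : 0 <= z by rewrite /z mulr_ge0.
(* [L ^ 2] is the sum of the squared weights, so [L] dominates each weight; this allows the
   denominator [1 + m w] below to be replaced by [1 + z]. *)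
have wL S : v \in S -> trace_wt p U S <= L.
  move=> vS; rewrite -(@ler_pXn2r _ 2) ?nnegrE ?trace_wt_ge0 // L2.
  by rewrite (bigD1 S) //= lerDl sumr_ge0 // => ? _; rewrite sqr_ge0.
have -> : z ^+ 2 / (1 + z) / m%:R = m%:R * L ^+ 2 / (1 + z).
  have [m0|m0] := eqVneq m 0%N; first by rewrite zm0 // m0 expr0n /= !mul0r.
  have : m%:R != 0 :> R by rewrite pnatr_eq0.
  have : 1 + z != 0 by rewrite lt0r_neq0 //; lra.
  by rewrite /z => ? ?; field; apply/andP.
rewrite L2 mulr_sumr mulr_suml -sumrN [X in _ + X]big_mkcond.
rewrite -[X in X + _](trace_wt_total p U) -big_split /=.
apply: ler_sum => S _; rewrite /g; case: ifPn => vS; last first.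
  by rewrite mulr0 oppr0 expR0 mulr1 addr0.
have w0 := trace_wt_ge0 p01 U S; set w := trace_wt p U S in w0 *.
have wl : w <= L by apply: wL.
have y0 : 0 <= m%:R * w by rewrite mulr_ge0.
apply: le_trans (ler_wpM2l w0 (expR_le_frac y0)) _.
rewrite mulrBr mulr1 lerD2l lerN2.
have -> : w * (m%:R * w / (1 + m%:R * w)) = m%:R * w ^+ 2 / (1 + m%:R * w).
  by rewrite mulrA; congr (_ / _); ring.
rewrite ler_wpM2l ?mulr_ge0 ?sqr_ge0 // lef_pV2 ?posrE; try lra.
by rewrite lerD2l ler_wpM2l.
Qed.

End Twins.

(** * From tail bounds to the localization number *)

Section LowerBound.
Variables (R : realType) (n : nat) (p : R).
Hypothesis p01 : 0 <= p <= 1.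
Local Notation V := 'I_n.
Implicit Types (G : graph V) (U W S : {set V}).

Lemma cop_wins_loc_number (T : finType) (G : graph T) :
  cop_wins G (loc_number G).
Proof. by rewrite /loc_number; case: ex_minnP => m /asboolP. Qed.

Lemma loc_number_le (T : finType) (G : graph T) k :
  cop_wins G k -> (loc_number G <= k)%N.
Proof.
by rewrite /loc_number; case: ex_minnP => m _ H /asboolP; apply: H.
Qed.

(** When any two vertices have a common neighbour, the distance to another vertex is 1 or 2 and
    adjacency decides which, so equal traces give equal signatures. Adding [v] to [W] makes both
    twins possible moves from [v]. *)
Lemma loc_number_ge G (K : R) : (0 < n)%N ->
  (forall x y, x != y -> exists w, adj G x w && adj G w y) ->
  (forall v W, #|W|%:R <= K -> ~~ twin_free v (v |: W) G) ->
  K <= (loc_number G)%:R.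
Proof.
move=> n0 diam notw; rewrite leNgt; apply/negP => /ltW lK.
apply: (@robber_wins _ G (loc_number G)) (cop_wins_loc_number G); last first.
  by rewrite card_ord; case: (n) n0.
move=> v W Wk; have := notw v W; rewrite Wk => /(_ lK).
rewrite negb_forall_in => /existsP[x /andP[xU]].
rewrite negb_forall_in => /existsP[y /andP[yU]].
rewrite negb_imply => /andP[/andP[vx /eqP tr] xy].
have trE u : u \in v |: W -> adj G x u = adj G y u.
  by move=> uU; move/setP/(_ u): tr; rewrite !in_setI uU !andbT !inE.
have vx' : adj G x v by move: vx; rewrite inE.
have vy' : adj G y v by rewrite -trE ?setU11.
exists x, y; split=> //; rewrite 1?adj_sym //.
apply/eqP/signatureP => w wW.
have wU : w \in v |: W by rewrite setU1r.
have xw : x != w by apply: contraTneq wU => <-; move: xU; rewrite inE.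
have yw : y != w by apply: contraTneq wU => <-; move: yU; rewrite inE.
have [a|na] := boolP (adj G x w).
  have /eqP -> : dist G x w == 1%N by rewrite dist_eq1.
  by apply/esym/eqP; rewrite dist_eq1 // -trE.
have [u /andP[xu uw]] := diam _ _ xw.
have [u' /andP[yu uw']] := diam _ _ yw.
by rewrite (dist_eq2 xw na xu uw) (dist_eq2 yw _ yu uw') // -trE.
Qed.

(** [z] bounds from below the parameter of the birthday bound for every test set of size at most
    [K], so one estimate serves the whole union over [v] and [W]. *)
Lemma gnp_loc_number_lower (K z : R) (m : nat) : (0 < n)%N -> 0 <= z ->
  m.*2%:R + K + 1 <= n%:R ->
  (forall k : nat, k%:R <= K -> z <= m%:R * (p * Num.sqrt (rho p ^+ k))) ->
  gnp_pr p (fun G => ~~ (K <= (loc_number G)%:R))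
  <= n%:R ^+ 2 * expR (- ((n%:R - 2) * p ^+ 2))
     + n%:R * expR (1 + K * ln n%:R - z ^+ 2 / (1 + z)).
Proof.
move=> n0 z0 mK zk.
pose E1 G := [exists xy : V * V, (xy.1 != xy.2) &&
    (trace_count [set xy.1; xy.2] (fun S => (xy.1 \in S) && (xy.2 \in S)) G == 0)%N].
pose E2 G := [exists vW : V * {set V}, (#|vW.2|%:R <= K) &&
    twin_free vW.1 (vW.1 |: vW.2) G].
have sub : subpred (fun G => ~~ (K <= (loc_number G)%:R)) (fun G => E1 G || E2 G).
  move=> G; apply: contraR; rewrite negb_or => /andP[nE1 nE2].
  apply: loc_number_ge => // [x y xy|v W WK].
    move: nE1; rewrite negb_exists => /forallP/(_ (x, y)); rewrite xy /=.
    rewrite -lt0n card_gt0 => /set0Pn[w]; rewrite !inE !eqxx /= orbT !andbT.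
    by move=> /and3P[_ wx wy]; exists w; rewrite wy adj_sym wx.
  move: nE2; rewrite negb_exists => /forallP/(_ (v, W)); by rewrite /= WK.
apply: (le_trans (gnp_pr_sub p01 sub)); apply: (le_trans (gnp_pr_or p01 _ _)).
apply: lerD; first exact: gnp_diameter_tail.
apply: (le_trans (gnp_pr_exists p01 _ _)).
set e := z ^+ 2 / (1 + z).
apply: (@le_trans _ _ (\sum_(vW : V * {set V} | #|vW.2|%:R <= K) expR (- e))).
  apply: ler_sum => -[v W] /= WK; set U := v |: W.
  have Uk : (#|U|.-1 <= #|W|)%N by rewrite cardsU1; case: (v \in W); rewrite //= add0n leq_pred.
  have mU : (m.*2 <= #|~: U|)%N.
    rewrite -(ler_nat R) card_setC.
    have : #|U|%:R <= 1 + #|W|%:R :> R.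
      by rewrite -(natrD _ 1) ler_nat cardsU1; case: (v \in W); rewrite /= ?leq_addl.
    by lra.
  apply: (le_trans (gnp_twin_free p01 (setU11 v W) mU)).
  rewrite ler_expR lerN2 /e -/U; set y := m%:R * _.
  have zy : z <= y by apply: zk; apply: le_trans WK; rewrite ler_nat.
  rewrite ler_pdivrMr; last lra.
  rewrite mulrAC ler_pdivlMr; last lra.
  have y0 : 0 <= y by lra.
  have d0 : 0 <= y - z by lra.
  (* Cross-multiplied, this is the monotonicity of [z ^ 2 / (1 + z)]. *)
  have : 0 <= (y - z) * (y + z + z * y).
    by rewrite mulr_ge0 // !addr_ge0 // mulr_ge0.
  by lra.
rewrite -(pair_big predT (fun W : {set V} => #|W|%:R <= K) (fun _ _ => expR _)) /=.
have -> : expR (1 + K * ln n%:R - e) = expR (1 + K * ln n%:R) * expR (- e) by rewrite expRD.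
have -> (x : R) : \sum_(v : V) x = n%:R * x by rewrite sumr_const card_ord mulr_natl.
rewrite ler_wpM2l //.
apply: le_trans (ler_wpM2r (expR_ge0 _) (card_small_sets K n0)).
by rewrite mulr_suml; under [leRHS]eq_bigr => W _ do rewrite mul1r.
Qed.

End LowerBound.

(* Averaging over w, some vertex leaves at most a fraction sigma of the pairs that
   are still unseparated. *)
Lemma greedy_separation (R : realType) (I T : finType) (ns : T -> pred I)
    (P : {set I}) (sigma : R) :
  (forall i, i \in P -> #|[set w | ns w i]|%:R <= sigma * #|T|%:R) ->
  (0 < #|T|)%N -> forall k : nat, exists2 W : {set T}, (#|W| <= k)%N &
    #|[set i in P | [forall w in W, ns w i]]|%:R <= sigma ^+ k * #|P|%:R.
Proof.
move=> Pns T0; elim=> [|k [W Wk HW]].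
  exists finset.set0; rewrite ?cards0 // expr0 mul1r ler_nat subset_leq_card //.
  by apply/subsetP => i; rewrite inE => /andP[].
set Q := [set i in P | _] in HW.
have s0 : Q != finset.set0 -> 0 <= sigma.
  move=> /set0Pn[i]; rewrite inE => /andP[/Pns h _].
  by move: (le_trans (ler0n _ _) h); rewrite pmulr_lge0 // ltr0n.
have [w Hw] : exists w, #|[set i in Q | ns w i]|%:R <= sigma * #|Q|%:R :> R.
  have [t0 _] : exists t0 : T, t0 \in [set: T] by apply/card_gt0P; rewrite cardsT.
  apply: contrapT => /forallNP H.
  have : \sum_(w : T) sigma * #|Q|%:R < \sum_(w : T) #|[set i in Q | ns w i]|%:R.
    apply: ltr_sum => [|w _]; first by apply/hasP; exists t0; rewrite ?mem_index_enum.
    by rewrite ltNge; apply/negP; apply: H.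
  apply/negP; rewrite -leNgt.
  under eq_bigr => w _ do rewrite -sum1_card natr_sum big_mkcond /=.
  rewrite exchange_big /= sumr_const.
  apply: (@le_trans _ _ (\sum_(i in Q) sigma * #|T|%:R)); last first.
    by rewrite sumr_const -[leLHS]mulr_natr -[leRHS]mulr_natr mulrAC.
  rewrite [leRHS]big_mkcond; apply: ler_sum => i _.
  case: ifP => iQ; last by rewrite big1 // => w _; rewrite inE iQ.
  apply: (@le_trans _ _ #|[set w | ns w i]|%:R).
    rewrite -sum1_card natr_sum [leRHS]big_mkcond; apply: ler_sum => w _.
    by rewrite !inE; move: iQ; rewrite inE => -> /=.
  by apply: Pns; move: iQ; rewrite inE => /andP[].
exists (w |: W).
  by rewrite cardsU1; case: (w \in W) => /=; [apply: leq_trans Wk _|].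
apply: (@le_trans _ _ #|[set i in Q | ns w i]|%:R).
  rewrite ler_nat subset_leq_card //; apply/subsetP => i.
  rewrite !inE => /andP[-> /forall_inP H] /=; rewrite H ?setU11 // andbT.
  by apply/forall_inP => v vW; rewrite H // setU1r.
apply: (le_trans Hw); have [->|Q0] := eqVneq Q finset.set0.
  rewrite cards0 mulr0; have [->|/set0Pn[i iP]] := eqVneq P finset.set0.
    by rewrite cards0 mulr0.
  rewrite mulr_ge0 // exprn_ge0 //.
  move: (le_trans (ler0n _ _) (Pns i iP)); by rewrite pmulr_lge0 // ltr0n.
by rewrite exprS -mulrA ler_wpM2l // s0.
Qed.

Lemma ex_superset_card (T : finType) (X : {set T}) (k : nat) :
  (#|X| <= k)%N -> (k <= #|T|)%N -> exists2 W : {set T}, X \subset W & #|W| = k.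
Proof.
move=> Xk kT; have [|A AX Ak] := @ex_subset_card _ (~: X) (k - #|X|)%N.
  by rewrite leq_subLR (cardsC X).
exists (X :|: A); first exact: finset.subsetUl.
rewrite cardsU Ak; suff -> : X :&: A = finset.set0 by rewrite cards0 subn0 subnKC.
by apply/eqP; rewrite setI_eq0 disjoints_subset -finset.setCS finset.setCK.
Qed.

(** * Upper bound: winning strategies from separation *)

Section UpperBound.
Variables (R : realType) (n : nat).
Local Notation V := 'I_n.
Variable G : graph V.
Implicit Types (A B W S C : {set V}).

(** Pairs are ordered, so a class of [a] vertices contributes [a (a - 1)] of them. *)
Definition off_diag A : {set V * V} :=
  [set xy | [&& xy.1 \in A, xy.2 \in A & xy.1 != xy.2]].

Lemma card_off_diag A : #|off_diag A| = (#|A| * #|A|.-1)%N.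
Proof.
have -> : off_diag A = finset.setX A A :\: [set (x, x) | x in A].
  apply/setP => -[x y]; rewrite !inE /=; case xA: (x \in A) => /=; last by rewrite andbF.
  case yA: (y \in A) => /=; last by rewrite andbF.
  rewrite andbT; congr (~~ _); apply/eqP/imsetP => [<-|[z _ [-> ->]] //].
  by exists x.
rewrite cardsDS; last first.
  by apply/subsetP => _ /imsetP[x xA ->]; rewrite inE xA.
rewrite cardsX card_in_imset; last by move=> x y _ _ [].
by case: #|A| => // k; rewrite mulnS addKn mulnC.
Qed.

Definition same_dist (w : V) : pred (V * V) :=
  fun xy => dist G xy.1 w == dist G xy.2 w.

Lemma same_dist_signature W x y :
  [forall w in W, same_dist w (x, y)] = (signature G W x == signature G W y).
Proof. by apply/forall_inP/signatureP => H w /H /eqP. Qed.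

Lemma signature_sub W W' x y : W \subset W' ->
  signature G W' x == signature G W' y -> signature G W x == signature G W y.
Proof.
move=> /subsetP s /signatureP H; apply/signatureP => w /s; exact: H.
Qed.

(** [W] is a resolving set in the sense of metric dimension, so the first test already ends the
    game. *)
Lemma resolving_cop_wins W :
  (forall x y, signature G W x == signature G W y -> x = y) ->
  cop_wins G #|W|.
Proof.
move=> inj; apply: cop_wins_shrink => S; exists W; split=> // x xM /=.
apply/orP; left; apply/card_le1_eqP => y z.
rewrite !inE => /andP[_ /eqP ey] /andP[_ /eqP ez].
by apply: inj; rewrite ey ez.
Qed.

Variable sigma : R.
Hypothesis sep : forall x y : V, x != y ->
  #|[set w | same_dist w (x, y)]|%:R <= sigma * n%:R.
Hypothesis n0 : (0 < n)%N.

Let cardV : (0 < #|V|)%N. Proof. by rewrite card_ord. Qed.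

(* A class C inside [moves S] with at least 2 and at least #|S| elements would
   contribute more unseparated pairs than sigma ^ k * (D * #|S|) ^ 2. *)
Lemma cop_wins_sparse (D : R) (k : nat) : (k <= n)%N -> 1 <= D ->
  (forall v, #|nbrs G v|%:R <= D) -> 0 <= sigma -> sigma ^+ k * D ^+ 2 < 1 / 2 ->
  cop_wins G k.
Proof.
move=> kn D1 deg s0 small; apply: cop_wins_shrink => S.
have [|W0 W0k HW] := @greedy_separation R _ V same_dist (off_diag (moves G S)) sigma _ cardV k.
  by move=> [x y]; rewrite !inE card_ord => /and3P[_ _]; apply: sep.
have [|W W0W Wk] := ex_superset_card W0k _; first by rewrite card_ord.
exists W; split=> // x xM; set C := [set y in _ | _] => /=.
apply/orP; case: (leqP #|C| 1) => C1; [by left | right].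
rewrite ltnNge; apply/negP => CS.
have S_gt0 : 0 < #|S|%:R :> R.
  rewrite ltr0n card_gt0; apply/set0Pn; move: xM; rewrite inE => /existsP[s /andP[sS _]].
  by exists s.
have movesD : #|moves G S|%:R <= #|S|%:R * D.
  apply: (@le_trans _ _ (\sum_(s in S) #|[set y | robber_move G s y]|%:R)).
    rewrite -natr_sum ler_nat.
    apply: (@leq_trans #|\bigcup_(s in S) [set y | robber_move G s y]|); last first.
      elim/big_rec2: _ => [|s A a _ le]; first by rewrite cards0.
      by apply: leq_trans (leq_card_setU _ _) _; rewrite leq_add2l.
    rewrite subset_leq_card //; apply/subsetP => y; rewrite inE => /existsP[s /andP[sS m]].
    by apply/bigcupP; exists s => //; rewrite inE.
  rewrite mulr_natl -sumr_const; apply: ler_sum => s _.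
  (* An isolated vertex has one move, to itself; [1 <= D] covers it. *)
  case: (boolP [forall w, ~~ adj G s w]) => [iso|niso].
    apply: le_trans D1; rewrite lern1 -(cards1 s) subset_leq_card //.
    apply/subsetP => y; rewrite !inE /robber_move.
    by have /forallP/(_ y)/negbTE -> := iso; rewrite /= eq_sym => /andP[].
  apply: le_trans (deg s); rewrite ler_nat subset_leq_card //.
  apply/subsetP => y; rewrite !inE /robber_move (negbTE niso) andbF orbF //.
have CP : off_diag C \subset
    [set i in off_diag (moves G S) | [forall w in W0, same_dist w i]].
  apply/subsetP => -[y z]; rewrite !inE same_dist_signature.
  move=> /and3P[/andP[-> ey] /andP[-> ez] ->] /=.
  by apply: (signature_sub W0W); rewrite (eqP ey) (eqP ez).
have : (#|C| * #|C|.-1)%:R <= sigma ^+ k * (#|S|%:R * D) ^+ 2.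
  rewrite -card_off_diag; apply: (@le_trans _ _ _ _ _ (le_trans _ HW)).
    by rewrite ler_nat subset_leq_card.
  rewrite ler_wpM2l ?exprn_ge0 // card_off_diag.
  apply: (@le_trans _ _ (#|moves G S|%:R ^+ 2)); last by rewrite lerXn2r ?nnegrE // mulr_ge0 // (le_trans _ D1).
  by rewrite -natrX ler_nat -mulnn leq_mul2l leq_pred orbT.
apply/negP; rewrite -ltNge exprMn mulrCA mulrC.
apply: (@lt_le_trans _ _ (1 / 2 * #|S|%:R ^+ 2)); first by rewrite ltr_pM2r // exprn_gt0.
(* As [#|C| >= 2], the product [#|C| (#|C| - 1)] is at least [#|C| ^ 2 / 2], and [#|C| >= #|S|]. *)
have : (#|S| ^ 2 <= (#|C| * #|C|.-1) * 2)%N.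
  by rewrite -mulnn; move: C1 CS; case: #|C| => [|[|c]] //= _; nia.
rewrite -(ler_nat R) natrM natrX; lra.
Qed.

(* After k - l greedy vertices at most 4 ^ l ordered pairs are left, so the classes
   have size at most 2 ^ l. Label the elements of each class by distinct l-bit
   words; the j-th of the last l vertices is adjacent exactly to those vertices
   whose label contains j. *)
Lemma cop_wins_dense (l k : nat) : (l <= k)%N -> (k <= n)%N ->
  (forall B S, (#|B| <= 4 ^ l)%N -> S \subset B ->
     exists2 w, w \notin B & nbrs G w :&: B = S) ->
  sigma ^+ (k - l) * n%:R ^+ 2 <= (4 ^ l)%:R -> 0 <= sigma ->
  cop_wins G k.
Proof.
move=> lk kn ext small s0.
have [|W0 W0k HW] := @greedy_separation R _ V same_dist (off_diag [set: V]) sigma _ cardV (k - l)%N.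
  by move=> [x y]; rewrite !inE card_ord => /and3P[_ _]; apply: sep.
set Q := [set i in _ | _] in HW.
have Q4 : (#|Q| <= 4 ^ l)%N.
  rewrite -(ler_nat R); apply: le_trans HW (le_trans _ small).
  rewrite ler_wpM2l ?exprn_ge0 // card_off_diag cardsT card_ord -natrX ler_nat.
  by rewrite -mulnn leq_mul2l leq_pred orbT.
have QE x y : ((x, y) \in Q) = (x != y) && (signature G W0 x == signature G W0 y).
  by rewrite !inE /= same_dist_signature.
pose B := [set xy.1 | xy in Q].
have B4 : (#|B| <= 4 ^ l)%N := leq_trans (leq_imset_card _ _) Q4.
pose C x := [set y | signature G W0 y == signature G W0 x].
(* A class of [2 ^ l + 1] vertices would give more than [4 ^ l] ordered pairs. *)
have Cl x : (#|C x| <= 2 ^ l)%N.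
  rewrite leqNgt; apply/negP => h.
  have : (#|off_diag (C x)| <= 4 ^ l)%N.
    apply: leq_trans Q4; apply/subset_leq_card/subsetP => -[y z].
    rewrite QE inE /= !inE => /and3P[/eqP ey /eqP ez ->] /=; by rewrite ey ez.
  rewrite card_off_diag (_ : 4 = 2 ^ 2)%N // -expnM [(2 * l)%N]mulnC expnM -mulnn.
  have : (0 < 2 ^ l)%N by rewrite expn_gt0.
  by move: h; move: (2 ^ l)%N => a; case: #|C x| => //= c; nia.
(* The rank of [x] in its class, turned into a subset of ['I_l]; the bound on the class sizes leaves
   enough subsets to make the labels distinct. *)
pose label x : {set 'I_l} := nth finset.set0 (enum {set 'I_l}) (index x (enum (C x))).
have Cx x : x \in C x by rewrite inE.
have idx x : (index x (enum (C x)) < size (enum {set 'I_l}))%N.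
  rewrite -cardE -cardsT -powersetT card_powerset cardsT card_ord.
  apply: leq_trans (Cl x).
  by rewrite [X in (_ < X)%N]cardE index_mem mem_enum.
have label_inj x y : signature G W0 x = signature G W0 y -> label x = label y -> x = y.
  move=> e /eqP; rewrite nth_uniq ?enum_uniq // => /eqP.
  have -> : C x = C y by apply/setP => z; rewrite !inE e.
  move=> /(congr1 (nth x (enum (C y)))); rewrite !nth_index ?mem_enum //.
  by rewrite inE e.
have /choice[f Hf] : forall j : 'I_l, exists w, (w \notin B) /\
    nbrs G w :&: B = [set x in B | j \in label x].
  move=> j; have [|w wB e] := ext B [set x in B | j \in label x] B4; last by exists w.
  by apply/subsetP => x; rewrite inE => /andP[].
pose W1 := W0 :|: [set f j | j in [set: 'I_l]].
have W1k : (#|W1| <= k)%N.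
  apply: leq_trans (leq_card_setU _ _) _.
  have h : (#|[set f j | j in [set: 'I_l]]| <= l)%N.
    by apply: leq_trans (leq_imset_card _ _) _; rewrite cardsT card_ord.
  by apply: leq_trans (leq_add W0k h) _; rewrite subnK.
have [|W W1W Wk] := ex_superset_card W1k _; first by rewrite card_ord.
rewrite -Wk; apply: resolving_cop_wins => x y sxy.
have s1 := signature_sub W1W sxy.
have s2 := signature_sub (finset.subsetUl W0 _) s1.
apply: contrapT => /eqP xy; move: (xy) => /eqP; apply.
have xB : x \in B by apply/imsetP; exists (x, y); rewrite ?QE ?xy.
have yB : y \in B by apply/imsetP; exists (y, x); rewrite ?QE 1?eq_sym ?xy //= eq_sym.
apply: label_inj; first exact/eqP.
apply/setP => j; have [fB fE] := Hf j.
have fxy : dist G x (f j) = dist G y (f j).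
  move/signatureP: s1; apply; rewrite inE; apply/orP; right.
  by apply/imsetP; exists j; rewrite ?inE.
(* [f j] lies outside [B], so distance 1 means adjacency. *)
have lab z : z \in B -> (j \in label z) = (dist G z (f j) == 1%N).
  move=> zB; rewrite dist_eq1; last by apply: contraTneq zB => ->.
  have := congr1 (fun A : {set V} => z \in A) fE.
  by rewrite !inE zB andbT /= adj_sym => ->.
by rewrite !lab // fxy.
Qed.

End UpperBound.

(** * Upper bound: failure probabilities *)

Section UpperTail.
Variables (R : realType) (n : nat) (p : R).
Hypothesis p01 : 0 <= p <= 1.
Hypothesis n0 : (0 < n)%N.
Local Notation V := 'I_n.

(** A vertex adjacent to exactly one of [x], [y] has distance 1 from just that one, so the two
    counted sets are disjoint. *)
Lemma same_dist_count (G : graph V) (x y : V) : x != y ->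
  (#|[set w | same_dist G w (x, y)]| +
   trace_count [set x; y] (fun S => (x \in S) != (y \in S)) G <= n)%N.
Proof.
move=> xy; rewrite /trace_count; set A := [set w | _]; set B := [set w in _ | _].
have <- : #|A :|: B| = (#|A| + #|B|)%N.
  rewrite cardsU; suff -> : A :&: B = finset.set0 by rewrite cards0 subn0.
  apply/eqP; rewrite -finset.subset0; apply/subsetP => w.
  rewrite !inE eqxx eqxx orbT /= !andbT /same_dist /= negb_or.
  move=> /andP[/eqP dE /andP[/andP[wx wy]]].
  rewrite ![adj G w _]adj_sym -!dist_eq1 1?[_ == w]eq_sym // dE.
  by rewrite eqxx.
by rewrite -[leqRHS](card_ord n) max_card.
Qed.

(** The proportion of vertices that may fail to separate a pair, once the separating counts are at
    least [1 - d] times their mean; it is [rho p] up to small errors. *)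
Definition sep_rate (d : R) : R :=
  1 - (1 - d) * ((n%:R - 2) * (2 * p * (1 - p))) / n%:R.

Definition unseparated d (G : graph V) : bool :=
  [exists xy : V * V, (xy.1 != xy.2) &&
    ((trace_count [set xy.1; xy.2] (fun S => (xy.1 \in S) != (xy.2 \in S)) G)%:R
     <= (1 - d) * ((n%:R - 2) * (2 * p * (1 - p))))].

Lemma separatedP d G : ~~ unseparated d G -> forall x y, x != y ->
  #|[set w | same_dist G w (x, y)]|%:R <= sep_rate d * n%:R.
Proof.
rewrite negb_exists => /forallP H x y xy; have := H (x, y).
rewrite /= xy /= -ltNge => h.
have := same_dist_count G xy; rewrite -(ler_nat R) natrD.
have n0' : n%:R != 0 :> R by rewrite pnatr_eq0 -lt0n.
by rewrite /sep_rate mulrBl mul1r divfK //; lra.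
Qed.

Lemma gnp_loc_number_sparse (d : R) (k : nat) : 0 <= d <= 1 -> (k <= n)%N ->
  0 <= sep_rate d -> 1 <= 4 * n%:R * p ->
  sep_rate d ^+ k * (4 * n%:R * p) ^+ 2 < 1 / 2 ->
  gnp_pr p (fun G : graph V => ~~ (loc_number G <= k)%N)
  <= n%:R ^+ 2 * expR (- ((n%:R - 2) * (2 * p * (1 - p)) * d ^+ 2 / 4))
     + n%:R * expR (- (n%:R * p)).
Proof.
move=> d01 kn s0 D1 small.
pose E2 (G : graph V) := [exists v, ~~ (#|nbrs G v|%:R <= 4 * n%:R * p)].
have sub : subpred (fun G : graph V => ~~ (loc_number G <= k)%N)
    (fun G : graph V => unseparated d G || E2 G).
  move=> G; apply: contraR; rewrite negb_or => /andP[nE1].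
  rewrite negb_exists => /forallP nE2; apply: loc_number_le.
  apply: cop_wins_sparse (separatedP nE1) n0 _ _ kn D1 _ s0 small.
  by move=> v; have := nE2 v; rewrite negbK.
apply: (le_trans (gnp_pr_sub p01 sub)); apply: (le_trans (gnp_pr_or p01 _ _)).
by apply: lerD; [exact: gnp_separation_tail | exact: gnp_degree_tail].
Qed.

Lemma gnp_loc_number_dense (d mu : R) (l k : nat) : 0 <= d <= 1 ->
  (l <= k)%N -> (k <= n)%N -> 0 <= sep_rate d ->
  0 <= mu -> mu <= p -> mu <= 1 - p -> (4 ^ l <= n)%N ->
  sep_rate d ^+ (k - l) * n%:R ^+ 2 <= (4 ^ l)%:R ->
  gnp_pr p (fun G : graph V => ~~ (loc_number G <= k)%N)
  <= n%:R ^+ 2 * expR (- ((n%:R - 2) * (2 * p * (1 - p)) * d ^+ 2 / 4))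
     + expR (2 * (1 + (4 ^ l)%:R * ln n%:R) - (n - 4 ^ l)%:R * mu ^+ (4 ^ l)).
Proof.
move=> d01 lk kn s0 mu0 mup muq ln4 small.
set b := (4 ^ l)%N in ln4 small *.
pose E2 (G : graph V) := [exists BS : {set V} * {set V},
      [&& (#|BS.1| <= b)%N, (#|BS.2| <= b)%N & BS.2 \subset BS.1] &&
      (trace_count BS.1 (pred1 BS.2) G == 0%N)].
have sub : subpred (fun G : graph V => ~~ (loc_number G <= k)%N)
    (fun G : graph V => unseparated d G || E2 G).
  move=> G; apply: contraR; rewrite negb_or => /andP[nE1].
  rewrite negb_exists => /forallP nE2; apply: loc_number_le.
  apply: cop_wins_dense (separatedP nE1) n0 _ _ lk kn _ small s0 => B S Bb SB.
  have := nE2 (B, S); rewrite /= Bb SB (leq_trans (subset_leq_card SB) Bb) /=.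
  rewrite -lt0n card_gt0 => /set0Pn[w]; rewrite !inE => /andP[wB /eqP e].
  by exists w.
apply: (le_trans (gnp_pr_sub p01 sub)); apply: (le_trans (gnp_pr_or p01 _ _)).
by apply: lerD; [exact: gnp_separation_tail | exact: gnp_extension_tail].
Qed.

End UpperTail.

(** * Numerical estimates for fixed n *)

Section FixedSize.
Variables (R : realType) (n : nat) (p L r : R).
Local Notation V := 'I_n.
Hypothesis L_def : L = ln n%:R.
Hypothesis r_def : r = ln (1 / rho p).
Hypothesis n0 : (0 < n)%N.
Hypothesis L64 : 64 <= L.
(** [expR (L / 2)] is the square root of [n]; this and [64 <= L] express that [n] is large. *)
Hypothesis sqrt_n : 48 * L ^+ 5 <= expR (L / 2).
Hypothesis p_gt0 : 0 < p.
Hypothesis np2 : 1 <= n%:R * p ^+ 2.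
Hypothesis q_ge : 1 / L <= 1 - p.

Local Lemma q_gt0 : 0 < 1 - p.
Proof. by apply: lt_le_trans q_ge; rewrite divr_gt0 //; have := L64; lra. Qed.

Local Lemma p01 : 0 <= p <= 1.
Proof. by apply/andP; split; [exact: ltW | have := q_gt0; lra]. Qed.

Local Lemma nE : n%:R = expR L.
Proof. by rewrite L_def lnK // posrE ltr0n. Qed.

Local Lemma nE2 : n%:R = expR (L / 2) ^+ 2.
Proof. by rewrite nE -expRM_natl; congr expR; field. Qed.

Local Lemma pE : p = expR (ln p).
Proof. by rewrite lnK ?posrE ?p_gt0. Qed.

Local Lemma lnp_ge : - L <= 2 * ln p.
Proof.
rewrite -ler_expR expRN -nE expRM_natl -pE.
by rewrite -[leLHS]mul1r ler_pdivrMr ?ltr0n // mulrC.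
Qed.

Local Lemma lnp_le0 : ln p <= 0.
Proof. by apply: ln_le0; have := q_gt0; lra. Qed.

Local Lemma sqrt_n_p : 1 <= expR (L / 2) * p.
Proof. by rewrite pE -expRD -[leLHS]expR0 ler_expR; have := lnp_ge; lra. Qed.

Local Lemma rhoE : rho p = 1 - 2 * p * (1 - p).
Proof. by rewrite /rho; ring. Qed.

Local Lemma rho_ge : 1 / 2 <= rho p.
Proof. by have := sqr_ge0 (1 - 2 * p); rewrite /rho; lra. Qed.

Local Lemma rho_gt0 : 0 < rho p. Proof. by apply: lt_le_trans rho_ge; lra. Qed.

Local Lemma rE : rho p = expR (- r).
Proof. by rewrite r_def div1r lnV ?posrE ?rho_gt0 // opprK lnK ?posrE ?rho_gt0. Qed.

Local Lemma r_ge : 2 * p * (1 - p) <= r.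
Proof.
have -> : r = - ln (1 + (rho p - 1)) by rewrite r_def div1r lnV ?posrE ?rho_gt0 // addrC subrK.
have := @le_ln1Dx R (rho p - 1); rewrite rhoE => h.
rewrite lerNr; apply: le_trans (h _) _; last lra.
by have := rho_ge; rewrite rhoE; lra.
Qed.

Local Lemma pq_gt0 : 0 < p * (1 - p). Proof. exact: mulr_gt0 p_gt0 q_gt0. Qed.

Local Lemma r_gt0 : 0 < r. Proof. by apply: lt_le_trans r_ge; rewrite -mulrA mulr_gt0 // pq_gt0. Qed.

Local Lemma r_le1 : r <= 1.
Proof.
rewrite r_def; have -> : 1 / rho p = 1 + (1 / rho p - 1) by ring.
apply: le_trans (le_ln1Dx _) _.
  by have : 0 < 1 / rho p; [rewrite divr_gt0 ?rho_gt0 | lra].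
have : 1 / rho p <= 2 by rewrite ler_pdivrMr ?rho_gt0 //; have := rho_ge; lra.
lra.
Qed.

Local Lemma ratio_le : 2 * L / r <= L / (p * (1 - p)).
Proof.
rewrite ler_pdivrMr ?r_gt0 // mulrAC ler_pdivlMr ?pq_gt0 //.
have L0 : 0 <= L by have := L64; lra.
by have := ler_wpM2l L0 r_ge; lra.
Qed.

Lemma gnp_lower_bound :
  gnp_pr p (fun G : graph V => ~~ (
    (1 - 2 * eta n p - 4 * ln L / L) * (2 * L / r) <= (loc_number G)%:R))
  <= 2 / n%:R.
Proof.
have p0 := p_gt0; have q0 := q_gt0; have r0 := r_gt0; have rho0 := rho_gt0.
have u0 := lnp_le0; have p1 : p <= 1 by case/andP: p01.
set K := _ * _.
have n_gt0 : 0 < n%:R :> R by rewrite ltr0n.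
have L_gt0 : 0 < L by have := L64; lra.
have [K0|K0] := lerP K 0.
  rewrite /gnp_pr big_pred0 ?divr_ge0 // => G.
  by apply/negbF; apply: le_trans K0 _.
have etaE : eta n p * L = - ln p.
  by rewrite /eta -L_def divfK ?lt0r_neq0 // div1r lnV.
have f_gt0 : 0 < 1 - 2 * eta n p - 4 * ln L / L.
  by move: K0; rewrite /K pmulr_lgt0 // divr_gt0 // mulr_gt0.
(* Positivity of [K] amounts to [n p ^ 2 > L ^ 4], which is extracted next. *)
have f_L : 0 < L + 2 * ln p - 4 * ln L.
  have := mulr_gt0 f_gt0 L_gt0.
  have -> : (1 - 2 * eta n p - 4 * ln L / L) * L =
    L - 2 * (eta n p * L) - 4 * (ln L / L * L) by ring.
  by rewrite etaE divfK ?lt0r_neq0 //; lra.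
have LE : L = expR (ln L) by rewrite lnK.
have L4 : L ^+ 4 = expR (4 * ln L) by rewrite expRM_natl -LE.
have np2' : L ^+ 4 <= n%:R * p ^+ 2.
  by rewrite L4 nE pE -expRM_natl -expRD ler_expR; have := lnp_ge; lra.
(* Equivalently, [rho ^ K] is the square of [L ^ 4 / (n p ^ 2)]. *)
have Kr : K * r = 2 * L + 4 * ln p - 8 * ln L.
  rewrite /K mulrA divfK ?lt0r_neq0 //.
  have -> : (1 - 2 * eta n p - 4 * ln L / L) * (2 * L) =
    2 * L - 4 * (eta n p * L) - 8 * (ln L / L * L) by ring.
  by rewrite etaE divfK ?lt0r_neq0 //; ring.
have lnL : 0 <= ln L by apply: ln_ge0; have := L64; lra.
have K_le : K <= L ^+ 2 / p.
  have f_le1 : 1 - 2 * eta n p - 4 * ln L / L <= 1.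
    have : 0 <= eta n p.
      by rewrite /eta -L_def divr_ge0 ?(ltW L_gt0) // div1r lnV ?posrE ?p_gt0 //; lra.
    have : 0 <= 4 * ln L / L by rewrite divr_ge0 ?mulr_ge0 ?(ltW L_gt0).
    lra.
  have h : K <= 2 * L / r.
    by rewrite /K -[leRHS]mul1r ler_wpM2r // divr_ge0 ?mulr_ge0 ?(ltW L_gt0) ?(ltW r_gt0).
  apply: le_trans h (le_trans ratio_le _).
  have -> : L / (p * (1 - p)) = L / p * (1 - p)^-1.
    by rewrite invfM mulrA.
  have -> : L ^+ 2 / p = L / p * L by rewrite expr2 mulrAC.
  rewrite ler_wpM2l ?divr_ge0 ?(ltW L_gt0) ?(ltW p0) //.
  by rewrite -[leRHS]invrK lef_pV2 ?posrE ?invr_gt0 // -div1r.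
have p_inv : p^-1 <= expR (L / 2).
  by rewrite -[leLHS]mul1r ler_pdivrMr // sqrt_n_p.
(* As [K <= n / 8], two disjoint sets of size [m] fit outside any [v |: W] with [#|W| <= K]. *)
pose m := (n %/ 8)%N.
have nm : n%:R = expR (L / 2) ^+ 2 :> R := nE2.
have big_s : 64 <= expR (L / 2).
  apply: le_trans L64 (le_trans _ sqrt_n); rewrite -[leLHS]mul1r.
  apply: ler_pM; rewrite ?(ltW L_gt0) ?ler1n //.
  by rewrite -[leLHS]expr1 ler_weXn2l //; have := L64; lra.
set s := expR (L / 2) in p_inv nm big_s.
have s_gt0 : 0 < s by apply: expR_gt0.
have mn : 8 * m%:R <= n%:R :> R /\ n%:R <= 8 * m%:R + 8 :> R.
  rewrite -natrM -(natrD _ _ 8) !ler_nat mulnC leq_trunc_div; split=> //.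
  by rewrite -[8%N in leqRHS]mul1n -mulnDl addn1 ltnW // ltn_ceil.
have n16 : 16 <= n%:R :> R.
  by rewrite nm expr2; have := ler_pM _ _ big_s big_s; lra.
have m_ge : n%:R / 16 <= m%:R :> R by case: mn; lra.
have KE : K <= n%:R / 8.
  apply: le_trans K_le _; apply: (@le_trans _ _ (L ^+ 2 * s)).
    by rewrite ler_wpM2l // exprn_ge0 // ltW.
  have h : L ^+ 2 * 8 <= s.
    apply: (@le_trans _ _ (8 * L ^+ 4)); last first.
      apply: le_trans sqrt_n; apply: ler_pM; rewrite ?exprn_ge0 ?(ltW L_gt0) ?ler_nat //.
      by rewrite ler_weXn2l //; have := L64; lra.
    have : L ^+ 2 * 1 <= L ^+ 2 * L ^+ 2.
      rewrite ler_wpM2l ?exprn_ge0 ?(ltW L_gt0) // exprn_ege1 //; have := L64; lra.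
    by rewrite -exprD; have := exprn_ge0 2 (ltW L_gt0); lra.
  by rewrite nm expr2; have := ler_wpM2r (ltW s_gt0) h; lra.
(* With [m >= n / 16] and [rho ^ (K / 2) = L ^ 4 / (n p ^ 2)], this is a lower bound for
   [m p rho ^ (K / 2)]. *)
pose z := L ^+ 4 / (16 * p).
have z0 : 0 <= z by rewrite divr_ge0 ?mulr_ge0 ?exprn_ge0 ?(ltW L_gt0) ?(ltW p0).
have zk (k : nat) : k%:R <= K -> z <= m%:R * (p * Num.sqrt (rho p ^+ k)).
  move=> kK.
  have h : L ^+ 4 / (n%:R * p ^+ 2) <= Num.sqrt (rho p ^+ k).
    have t0 : 0 <= L ^+ 4 / (n%:R * p ^+ 2).
      by rewrite divr_ge0 ?mulr_ge0 ?exprn_ge0 ?(ltW L_gt0) ?(ltW p0).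
    rewrite -[leLHS]ger0_norm // -sqrtr_sqr ler_wsqrtr //.
    have -> : (L ^+ 4 / (n%:R * p ^+ 2)) ^+ 2 = expR (- (K * r)).
      rewrite L4 nE [in p ^+ 2]pE -[expR (ln p) ^+ 2]expRM_natl -expRD -expRB.
      by rewrite -expRM_natl Kr; congr expR; ring.
    rewrite rE -expRM_natl ler_expR mulrN lerN2 ler_wpM2r // ltW //.
  apply: (@le_trans _ _ (n%:R / 16 * (p * (L ^+ 4 / (n%:R * p ^+ 2))))).
    rewrite le_eqVlt; apply/orP; left; apply/eqP; rewrite /z; field.
    by rewrite !lt0r_neq0.
  apply: ler_pM => //; first by rewrite divr_ge0.
    rewrite mulr_ge0 ?(ltW p0) // divr_ge0 ?exprn_ge0 ?(ltW L_gt0) //.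
    by rewrite mulr_ge0 ?sqr_ge0.
  by rewrite ler_wpM2l // ltW.
have mK : m.*2%:R + K + 1 <= n%:R by rewrite -mul2n natrM; case: mn; lra.
apply: le_trans (gnp_loc_number_lower p01 n0 z0 mK zk) _.
have -> : 2 / n%:R = expR (- L) + expR (- L) :> R by rewrite expRN -nE; field; rewrite lt0r_neq0.
have Lpow k : 64 * L ^+ k <= L ^+ k.+1.
  by rewrite exprS ler_wpM2r ?exprn_ge0 ?(ltW L_gt0) // L64.
have L1 := Lpow 1%N; have L2 := Lpow 2%N; have L3 := Lpow 3%N.
rewrite expr1 in L1; have L6 := L64.
apply: lerD.
  rewrite nE -expRM_natl -expRD ler_expR -nE.
  have : n%:R / 2 * p ^+ 2 <= (n%:R - 2) * p ^+ 2 by rewrite ler_wpM2r ?sqr_ge0 //; lra.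
  lra.
rewrite -L_def [X in X * _]nE -expRD ler_expR.
(* Since [z >= 1], the birthday exponent is at least [z / 2 = L ^ 4 / (32 p)], which beats the cost
   [K L <= L ^ 3 / p] of the choice of [W]. *)
have hz : z / 2 <= z ^+ 2 / (1 + z).
  have z1 : 1 <= z.
    rewrite /z ler_pdivlMr ?mulr_gt0 //; lra.
  rewrite ler_pdivlMr; last lra.
  by have := mulr_ge0 z0 (_ : 0 <= z - 1); rewrite subr_ge0 => /(_ z1); lra.
have hK : K * L <= L ^+ 3 / p.
  by have := ler_wpM2r (ltW L_gt0) K_le; have -> : L ^+ 2 / p * L = L ^+ 3 / p by rewrite mulrAC -exprSr.
have e1 : z / 2 = L ^+ 4 / 32 / p by rewrite /z; field; rewrite lt0r_neq0.
have e2 : L ^+ 3 <= (L ^+ 4 / 32 - L ^+ 3) / p.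
  rewrite ler_pdivlMr //; have := ler_wpM2l (exprn_ge0 3 (ltW L_gt0)) p1; lra.
rewrite mulrBl in e2.
lra.
Qed.

(** * The upper bound for fixed n *)

Variable c : R.
Hypothesis c01 : 0 < c < 1.
Local Notation Ub := ((1 - c * eta n p) * (2 * L / r)).
(** This slack in the separation counts is small enough to cost only a factor 2 over
    [Ub <= L / (p (1 - p))] vertices, and large enough for the tail bound. *)
Local Notation d := (1 / (16 * L)).

Local Lemma L_gt0 : 0 < L. Proof. by have := L64; lra. Qed.

Local Lemma etaE : eta n p * L = - ln p.
Proof. by rewrite /eta -L_def divfK ?lt0r_neq0 ?L_gt0 // div1r lnV ?posrE ?p_gt0. Qed.

Local Lemma eta01 : 0 <= eta n p <= 1 / 2.
Proof.
have l0 := L_gt0; have := etaE => e; have h := lnp_ge; have h' := lnp_le0.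
apply/andP; split; first by rewrite -(pmulr_lge0 _ l0) e; lra.
by rewrite -(ler_pM2r l0) e; lra.
Qed.

(** [Ub] is such that [rho ^ Ub = n ^ -2 p ^ (- 2 c)]. *)
Local Lemma UbE : Ub * r = 2 * L + 2 * c * ln p.
Proof.
rewrite mulrA divfK ?lt0r_neq0 ?r_gt0 //.
have -> : (1 - c * eta n p) * (2 * L) = 2 * L - 2 * c * (eta n p * L) by ring.
by rewrite etaE; ring.
Qed.

Local Lemma factor01 : 1 / 2 <= 1 - c * eta n p <= 1.
Proof.
case/andP: eta01 => e0 e1; case/andP: c01 => c0 c1.
have h : 0 <= c * eta n p by rewrite mulr_ge0 // ltW.
have h' : c * eta n p <= 1 * eta n p by rewrite ler_wpM2r // ltW.
by apply/andP; split; lra.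
Qed.

Local Lemma Ub_ge : L <= Ub.
Proof.
case/andP: factor01 => f0 f1; have l0 := L_gt0; have r0 := r_gt0.
have h : 2 * L <= 2 * L / r.
  rewrite ler_pdivlMr // ler_piMr ?r_le1 //; lra.
have h2 : 0 <= 2 * L / r by lra.
by have := ler_wpM2r h2 f0; lra.
Qed.

Local Lemma Ub_le : Ub * (p * (1 - p)) <= L.
Proof.
case/andP: factor01 => f0 f1; have l0 := L_gt0.
rewrite -ler_pdivlMr ?pq_gt0 //; apply: le_trans ratio_le.
have r0 := r_gt0; have h2 : 0 <= 2 * L / r by rewrite divr_ge0 ?mulr_ge0 // ltW.
by have := ler_wpM2r h2 f1; lra.
Qed.

Local Lemma sqrt_n_ge : L <= expR (L / 2).
Proof.
apply: le_trans sqrt_n; rewrite -[leLHS]mul1r.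
apply: ler_pM; rewrite ?(ltW L_gt0) ?ler1n //.
by rewrite -[leLHS]expr1 ler_weXn2l //; have := L64; lra.
Qed.

Local Lemma n_large : 64 * L <= n%:R.
Proof.
have l0 := L_gt0; rewrite nE2 expr2; apply: ler_pM => //; rewrite ?(ltW l0) //.
  exact: le_trans L64 sqrt_n_ge.
exact: sqrt_n_ge.
Qed.

Local Lemma d01 : 0 <= d <= 1.
Proof.
have h := L64; have l0 := L_gt0; apply/andP; split; first by rewrite divr_ge0 //; lra.
by rewrite ler_pdivrMr; lra.
Qed.

Local Lemma sep_rate_ge0 : 0 <= sep_rate n p d.
Proof.
have h := L64; have l0 := L_gt0; have nl := n_large; case/andP: d01 => h0 h1.
rewrite /sep_rate subr_ge0 ler_pdivrMr; last lra.
have h3 : (n%:R - 2) * (2 * p * (1 - p)) <= n%:R * 1.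
  apply: ler_pM; try lra.
    by rewrite -mulrA mulr_ge0 // ltW // pq_gt0.
  by have := rhoE; have := rho_ge; lra.
have h4 : (1 - d) * ((n%:R - 2) * (2 * p * (1 - p))) <= 1 * (n%:R * 1).
  apply: ler_pM; try lra.
  rewrite mulr_ge0 //; first lra.
  by rewrite -mulrA mulr_ge0 // ltW // pq_gt0.
lra.
Qed.

Local Lemma sep_rate_le : sep_rate n p d <= rho p * expR (8 * (p * (1 - p)) * d).
Proof.
have h := L64; have l0 := L_gt0; have nl := n_large; case/andP: d01 => h0 h1.
have q0 := pq_gt0; set y := p * (1 - p) in q0 *.
have n0' : n%:R != 0 :> R by apply: lt0r_neq0; lra.
(* Absorbs into [d] the loss from [n - 2] in place of [n]. *)
have hd : 2 / n%:R <= d.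
  by rewrite ler_pdivrMr; [rewrite mulrAC ler_pdivlMr; lra | lra].
have e : sep_rate n p d <= rho p + 4 * y * d.
  have -> : sep_rate n p d = rho p + 2 * y * d + (1 - d) * y * 2 * (2 / n%:R).
    by rewrite /sep_rate rhoE /y; field; rewrite n0' lt0r_neq0.
  have : (1 - d) * y * 2 * (2 / n%:R) <= 1 * y * 2 * d.
    have y0 : 0 <= y by apply: ltW.
    have d1 : 0 <= 1 - d by rewrite subr_ge0.
    apply: ler_pM => //; first exact: mulr_ge0 (mulr_ge0 d1 y0) (ler0n _ 2).
      by rewrite divr_ge0.
    by rewrite !ler_wpM2r // lerBlDr lerDl.
  lra.
apply: le_trans e _.
apply: (@le_trans _ _ (rho p * (1 + 8 * y * d))).
  have : 0 <= (2 * rho p - 1) * (y * d).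
    have a : 0 <= 2 * rho p - 1 by have := rho_ge; lra.
    exact: mulr_ge0 a (mulr_ge0 (ltW q0) h0).
  lra.
by rewrite ler_wpM2l ?expR_ge1Dx // ltW // rho_gt0.
Qed.

(** The error accumulated over [j] factors is at most [exp (8 j p (1 - p) d) <= exp (1 / 2) <=
    2]. *)
Local Lemma sep_rate_pow (j : nat) : j%:R <= Ub -> sep_rate n p d ^+ j <= 2 * rho p ^+ j.
Proof.
move=> jU; have rho0 := rho_gt0.
apply: (@le_trans _ _ ((rho p * expR (8 * (p * (1 - p)) * d)) ^+ j)).
  rewrite lerXn2r ?nnegrE ?sep_rate_ge0 ?sep_rate_le //.
  by rewrite mulr_ge0 ?expR_ge0 // ltW.
rewrite exprMn mulrC ler_wpM2r ?exprn_ge0 ?(ltW rho0) // -expRM_natl.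
have l0 := L_gt0; have q0 := pq_gt0.
have h : j%:R * (8 * (p * (1 - p)) * d) <= 1 / 2.
  have e := le_trans (ler_wpM2r (ltW q0) jU) Ub_le.
  have -> : j%:R * (8 * (p * (1 - p)) * d) = j%:R * (p * (1 - p)) / L / 2.
    by field; rewrite lt0r_neq0.
  by rewrite ler_wpM2r ?invr_ge0 // ler_pdivrMr // mul1r.
apply: (@le_trans _ _ (expR (1 / 2))); first by rewrite ler_expR.
have := expR_ge1Dx (- (1 / 2) : R); rewrite expRN => H.
by rewrite -lef_pV2 ?posrE ?expR_gt0 //; apply: le_trans H; lra.
Qed.

Local Lemma rho_pow (j : nat) : Ub <= j%:R ->
  rho p ^+ j <= expR (- (2 * c * ln p)) / n%:R ^+ 2.
Proof.
move=> jU; rewrite rE -expRM_natl nE -expRM_natl -expRB ler_expR mulrN.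
have := ler_wpM2r (ltW r_gt0) jU; rewrite UbE; lra.
Qed.

(** The exponent is at least [sqrt n / (1024 L ^ 3) >= 3 L], because [n p >= sqrt n] and
    [1 - p >= 1 / L]; of this [2 L] pays for the pairs. *)
Local Lemma separation_tail :
  n%:R ^+ 2 * expR (- ((n%:R - 2) * (2 * p * (1 - p)) * d ^+ 2 / 4)) <= 1 / n%:R.
Proof.
have h := L64; have l0 := L_gt0; have nl := n_large; case/andP: d01 => h0 h1.
have -> : 1 / n%:R = expR (- L) :> R by rewrite expRN -nE div1r.
rewrite [X in X ^+ 2 * _]nE -expRM_natl -expRD ler_expR.
have p0 := p_gt0; have q0 := q_gt0; have s1 := sqrt_n_p.
have e5 : 48 * L ^+ 5 <= expR (L / 2) := sqrt_n.
have e4 : 64 * L ^+ 4 <= L ^+ 5 by rewrite [leRHS]exprS ler_wpM2r ?exprn_ge0 ?(ltW l0).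
have nm := nE2; set s := expR (L / 2) in s1 e5 nm *.
have s0 : 0 < s by apply: expR_gt0.
have np : s <= n%:R * p.
  by rewrite nm expr2 -mulrA -[leLHS]mulr1 ler_wpM2l // ltW.
have qL : 1 <= (1 - p) * L by rewrite -ler_pdivrMr // q_ge.
have e : 3 * L <= s / (1024 * L ^+ 3).
  by rewrite ler_pdivlMr ?mulr_gt0 ?exprn_gt0 //; lra.
have e2 : s / (1024 * L ^+ 3) <= n%:R * p * ((1 - p) * L) / (1024 * L ^+ 3).
  rewrite ler_wpM2r ?invr_ge0 ?mulr_ge0 ?exprn_ge0 ?(ltW l0) //.
  by rewrite -[leLHS]mulr1; apply: ler_pM => //; rewrite ltW.
have e3 : n%:R * p * ((1 - p) * L) / (1024 * L ^+ 3) =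
   n%:R / 2 * (2 * p * (1 - p)) * d ^+ 2 / 4 by field; rewrite lt0r_neq0.
have e6 : n%:R / 2 * (2 * p * (1 - p)) * d ^+ 2 / 4 <=
   (n%:R - 2) * (2 * p * (1 - p)) * d ^+ 2 / 4.
  rewrite ler_wpM2r ?invr_ge0 // ler_wpM2r ?sqr_ge0 // ler_wpM2r //; last lra.
  by rewrite -mulrA mulr_ge0 // mulr_ge0 // ltW.
lra.
Qed.

(** Reduces to the integer part [k] of [Ub]; if it exceeds [n], the trivial bound [n] on the
    localization number suffices. *)
Lemma gnp_upper_bound_of (b : R) :
  (forall k : nat, k%:R <= Ub -> Ub < k.+1%:R -> (k <= n)%N ->
   gnp_pr p (fun G : graph V => ~~ (loc_number G <= k)%N) <= b) ->
  0 <= b ->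
  gnp_pr p (fun G : graph V => ~~ ((loc_number G)%:R <= Ub)) <= b.
Proof.
move=> H b0; have U0 : 0 <= Ub by apply: le_trans (ltW L_gt0) Ub_ge.
have sub : subpred (fun G : graph V => ~~ ((loc_number G)%:R <= Ub))
   (fun G : graph V => ~~ (loc_number G <= Num.truncn Ub)%N).
  move=> G; apply: contra => h; apply: le_trans (_ : (Num.truncn Ub)%:R <= _).
    by rewrite ler_nat.
  by case/andP: (truncn_itv U0).
apply: (le_trans (gnp_pr_sub p01 sub)).
have /andP[kU Uk] := truncn_itv U0.
have [kn|kn] := leqP (Num.truncn Ub) n; first exact: H.
rewrite /gnp_pr big_pred0 // => G; apply/negbF; apply: leq_trans (ltnW kn).
by rewrite -[leqRHS](card_ord n); apply: loc_number_le; apply: cop_wins_card.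
Qed.

Lemma gnp_upper_bound_sparse : (2 - 2 * c) * ln p <= - 8 ->
  gnp_pr p (fun G : graph V => ~~ ((loc_number G)%:R <= Ub)) <= 2 / n%:R.
Proof.
move=> small; have h := L64; have l0 := L_gt0; have nl := n_large.
have p0 := p_gt0; have s1 := sqrt_n_p.
have nm := nE2; have sL : 2 * L <= expR (L / 2).
  apply: le_trans sqrt_n; apply: ler_pM; rewrite ?(ltW l0) ?ler_nat //.
  by rewrite -[leLHS]expr1 ler_weXn2l //; lra.
set s := expR (L / 2) in s1 sL nm *.
have s0 : 0 < s by apply: expR_gt0.
have np : s <= n%:R * p.
  by rewrite nm expr2 -mulrA -[leLHS]mulr1 ler_wpM2l // ltW.
apply: gnp_upper_bound_of => [k kU Uk kn|]; last by rewrite divr_ge0.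
have -> : 2 / n%:R = 1 / n%:R + 1 / n%:R :> R by field; apply: lt0r_neq0; lra.
apply: le_trans (gnp_loc_number_sparse p01 n0 d01 kn sep_rate_ge0 _ _) _.
- lra.
(* Rounding [Ub] down costs a factor of at most [1 / rho <= 2]. *)
- have rk : rho p ^+ k <= 2 * (expR (- (2 * c * ln p)) / n%:R ^+ 2).
    apply: le_trans (_ : 2 * rho p ^+ k.+1 <= _).
      rewrite exprS mulrA ler_peMl ?exprn_ge0 ?(ltW rho_gt0) //.
      have := rho_ge; lra.
    by rewrite ler_wpM2l // rho_pow // ltW.
  have sk : sep_rate n p d ^+ k <= 4 * (expR (- (2 * c * ln p)) / n%:R ^+ 2).
    have -> : 4 = 2 * 2 :> R by ring.
    by apply: le_trans (sep_rate_pow kU) _; rewrite -[leRHS]mulrA ler_wpM2l.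
  (* Two factors 2 and the 16 from [(4 n p) ^ 2] give 64 times [p ^ (2 - 2 c)], which is at most
     [exp (- 8) <= 2 ^ -8]. *)
  apply: (@le_lt_trans _ _ (64 * expR ((2 - 2 * c) * ln p))).
    apply: le_trans (ler_wpM2r (sqr_ge0 _) sk) _.
    have -> : (2 - 2 * c) * ln p = - (2 * c * ln p) + 2 * ln p by ring.
    rewrite expRD expRM_natl -pE le_eqVlt; apply/orP; left; apply/eqP.
    field; apply: lt0r_neq0; lra.
  have e8 : expR ((2 - 2 * c) * ln p) <= (expR (1 : R) ^+ 8)^-1.
    by rewrite -expRM_natl mulr1 -expRN ler_expR.
  have e2 : 2 ^+ 8 <= expR (1 : R) ^+ 8.
    by rewrite lerXn2r ?nnegrE ?expR_ge0 //; have := expR_ge1Dx (1 : R); lra.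
  have e9 : (expR (1 : R) ^+ 8)^-1 <= (2 ^+ 8)^-1.
    by rewrite lef_pV2 ?posrE ?exprn_gt0 ?expR_gt0.
  apply: (@le_lt_trans _ _ (64 * (2 ^+ 8)^-1)); last lra.
  by apply: ler_wpM2l => //; apply: le_trans e9.
apply: lerD; first exact: separation_tail.
have -> : 1 / n%:R = expR (- L) :> R by rewrite expRN -nE div1r.
rewrite [X in X * _]nE -expRD ler_expR; lra.
Qed.

(** Here [p] is at least the constant [exp (- t)], and [l] absorbs the losses: 2 from [sep_rate],
    [2 ^ (l + 1)] from stopping the greedy choice [l] vertices early and rounding, [exp (2 t)] from
    [p ^ (- 2 c)]. Their product is at most [4 ^ l]. *)
Lemma gnp_upper_bound_dense (t : R) (l : nat) : 0 <= t -> - t <= ln p ->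
  4 * expR (2 * t) <= 2 ^+ l -> l.+1%:R <= L -> 4 ^+ l <= L -> expR t <= L ->
  (4 * 4 ^+ l + 6) * L ^+ (4 ^ l).+1 <= expR (L / 2) ->
  gnp_pr p (fun G : graph V => ~~ ((loc_number G)%:R <= Ub)) <= 2 / n%:R.
Proof.
move=> t0 pt l_ge lL bL tL grow; have h := L64; have l0 := L_gt0; have nl := n_large.
have p0 := p_gt0; have rho0 := rho_gt0.
apply: gnp_upper_bound_of => [k kU Uk kn|]; last by rewrite divr_ge0.
have -> : 2 / n%:R = 1 / n%:R + 1 / n%:R :> R by field; apply: lt0r_neq0; lra.
have lk : (l <= k)%N.
  by rewrite -ltnS -(ltr_nat R); apply: lt_trans Uk; apply: lt_le_trans Ub_ge;
     apply: lt_le_trans lL; rewrite ltr_nat.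
have bn : (4 ^ l)%:R <= L :> R by rewrite natrX.
have mu0 : 0 <= 1 / L by rewrite divr_ge0 // ltW.
have mup : 1 / L <= p.
  rewrite pE; apply: (@le_trans _ _ (expR (- t))); last by rewrite ler_expR.
  by rewrite expRN div1r lef_pV2 ?posrE ?expR_gt0.
apply: le_trans (gnp_loc_number_dense p01 n0 d01 lk kn sep_rate_ge0 mu0 mup q_ge _ _) _.
- rewrite -(ler_nat R); apply: le_trans bn _; lra.
- have kl : (k - l)%:R <= Ub.
    by apply: le_trans kU; rewrite ler_nat leq_subr.
  apply: le_trans (ler_wpM2r (sqr_ge0 _) (sep_rate_pow kl)) _.
  have rk := rho_pow (ltW Uk).
  have rkl : rho p ^+ (k - l) <= 2 ^+ l.+1 * rho p ^+ k.+1.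
    have -> : k.+1 = (l.+1 + (k - l))%N by rewrite addSn subnKC.
    rewrite exprD mulrA -exprMn ler_peMl ?exprn_ge0 ?(ltW rho0) //.
    by rewrite exprn_ege1 //; have := rho_ge; lra.
  apply: (@le_trans _ _ (2 * (2 ^+ l.+1 * expR (- (2 * c * ln p))))).
    have n2 : 0 < n%:R ^+ 2 :> R by rewrite exprn_gt0 //; lra.
    rewrite -[leLHS]mulrA ler_wpM2l // -ler_pdivlMr // -[leRHS]mulrA.
    apply: le_trans rkl _; rewrite ler_wpM2l ?exprn_ge0 //.
  have e : expR (- (2 * c * ln p)) <= expR (2 * t).
    rewrite ler_expR; case/andP: c01 => c0 c1.
    have hp := lnp_le0; have : c * (- ln p) <= 1 * t by apply: ler_pM; lra.
    lra.
  rewrite natrX exprS.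
  have -> : 4 ^+ l = 2 ^+ l * 2 ^+ l :> R by rewrite -exprMn; congr (_ ^+ _); ring.
  have w : 0 <= 2 ^+ l :> R by rewrite exprn_ge0.
  have := ler_wpM2l w l_ge; have := ler_wpM2l w e; lra.
apply: lerD; first exact: separation_tail.
have -> : 1 / n%:R = expR (- L) :> R by rewrite expRN -nE div1r.
rewrite -L_def ler_expR natrB; last by rewrite -(ler_nat R); apply: le_trans bn _; lra.
rewrite natrX; set b := (4 ^ l)%N in grow *; set B := 4 ^+ l in bL grow *.
have B0 : 0 <= B by rewrite exprn_ge0.
have Lb : 0 < L ^+ b by rewrite exprn_gt0.
(* Powers of [L] are negligible against [n], so the lower bound [(n - b) / L ^ b] for the expected
   number of vertices with a given trace beats the count of [B] and [S]. *)
have nb : (4 * B + 6) * L * L ^+ b <= n%:R.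
  rewrite nE2; set s := expR _ in grow *; rewrite -[leLHS]mulrA -[L * L ^+ b]exprS.
  apply: le_trans grow _; have hs : L <= s := sqrt_n_ge.
  have : s * 1 <= s * s by rewrite ler_wpM2l ?expR_ge0 //; lra.
  by rewrite mulr1 -expr2.
have nb2 : (2 * B + 3) * L <= (n%:R - B) * (1 / L) ^+ b.
  rewrite expr_div_n expr1n mul1r ler_pdivlMr //; lra.
have : B * 1 <= B * L by rewrite ler_wpM2l //; lra.
lra.
Qed.

End FixedSize.

(** * The limit *)

Lemma near_ln_ge (R : realType) (M : R) : \forall n \near \oo, M <= ln (n%:R : R).
Proof.
near=> n; rewrite -[M]expRK.
have h : expR M <= n%:R by near: n; exact: nbhs_infty_ger.
by rewrite ler_ln ?posrE ?expR_gt0 //; apply: lt_le_trans h; apply: expR_gt0.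
Unshelve. all: by end_near. Qed.

(** [exp (x / 2)] exceeds its Taylor term of degree [j + 1], which beats [C x ^ j] once [x] is
    large. *)
Lemma near_ln_pow_le (R : realType) (C : R) (j : nat) : 0 <= C ->
  \forall n \near \oo, C * ln (n%:R : R) ^+ j <= expR (ln n%:R / 2).
Proof.
move=> C0; near=> n.
have : 1 <= ln (n%:R : R) by near: n; exact: near_ln_ge.
have : C * (2 ^+ j.+1 * j.+1`!%:R) <= ln (n%:R : R) by near: n; exact: near_ln_ge.
move: (ln _) => x xM x1; have x0 : 0 < x by apply: lt_le_trans x1.
have D0 : 0 < 2 ^+ j.+1 * j.+1`!%:R :> R.
  by rewrite mulr_gt0 ?exprn_gt0 // ltr0n fact_gt0.
apply: (@le_trans _ _ (1 + (x / 2) ^+ j.+1 / j.+1`!%:R)); last first.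
  by apply: expR_ge1Dxn; rewrite divr_ge0 // ltW.
apply: (@le_trans _ _ (x ^+ j.+1 / (2 ^+ j.+1 * j.+1`!%:R))).
  rewrite ler_pdivlMr // mulrAC [leRHS]exprS ler_wpM2r ?exprn_ge0 //.
  exact: ltW.
by rewrite expr_div_n -mulrA -invfM lerDr.
Unshelve. all: by end_near. Qed.

Theorem theorem2 (R : realType) (omega p : nat -> R) (c : R) :
  omega n @[n --> \oo] --> +oo ->
  omega =o_\oo (fun n : nat => ln (n%:R : R)) ->
  (\forall n \near \oo,
     Num.sqrt ((2 * ln n%:R + omega n) / n%:R) <= p n
       <= 1 - 3 * ln (ln n%:R) / ln n%:R) ->
  0 < c ->
  (\forall n \near \oo,
     c < Num.min
           (1 / 2 * ((ln n%:R - 3 * ln (ln n%:R)) / ln (1 / p n) - 1)) 1) ->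
  gnp_pr (p n)
    (fun G : graph 'I_n =>
       (1 - 2 * eta n (p n) - 4 * ln (ln n%:R) / ln n%:R)
           * (2 * ln n%:R / ln (1 / rho (p n)))
         <= (loc_number G)%:R
         <= (1 - c * eta n (p n)) * (2 * ln n%:R / ln (1 / rho (p n))))
    @[n --> \oo] --> (1 : R).
Proof.
move=> /cvgryPge/(_ 0) omega_ge0 _ hp c0 hc.
have c1 : c < 1.
  have [n] := @filter_ex _ _ _ _ hc.
  by rewrite lt_min => /andP[].
(* [t] separates the two cases of the upper bound: [ln p <= - t] gives [(2 - 2 c) ln p <= - 8]. Then
   [l] is chosen for the other case. *)
pose t : R := 8 / (2 - 2 * c).
have t0 : 0 <= t by rewrite /t divr_ge0 //; lra.
have tc : (2 - 2 * c) * t = 8 by rewrite /t mulrC divfK // lt0r_neq0 //; lra.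
pose l := (Num.truncn (4 * expR (2 * t))).+1.
have l_ge : 4 * expR (2 * t) <= 2 ^+ l.
  have /truncn_itv/andP[_ /ltW h] : 0 <= 4 * expR (2 * t).
    by rewrite mulr_ge0 ?expR_ge0.
  by apply: le_trans h _; rewrite -natrX ler_nat -/l ltnW // ltn_expl.
clearbody l t.
apply/cvgrPdist_le => e e0; near=> n.
(* The total failure probability will be at most [4 / n <= e]. *)
have en : 4 / e <= n%:R by near: n; exact: nbhs_infty_ger.
have n_gt0 : 0 < n%:R :> R by apply: lt_le_trans en; rewrite divr_gt0.
have n0 : (0 < n)%N by rewrite -(ltr0n R).
have w0 : 0 <= omega n by near: n.
have pn : Num.sqrt ((2 * ln n%:R + omega n) / n%:R) <= p n
       <= 1 - 3 * ln (ln n%:R) / ln n%:R by near: n.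
have L64 : 64 <= ln (n%:R : R) by near: n; exact: near_ln_ge.
have sqrt_n : 48 * ln (n%:R : R) ^+ 5 <= expR (ln n%:R / 2).
  by near: n; exact: near_ln_pow_le.
have Ll : l.+1%:R <= ln (n%:R : R) by near: n; exact: near_ln_ge.
have Lb : 4 ^+ l <= ln (n%:R : R) by near: n; exact: near_ln_ge.
have Lt : expR t <= ln (n%:R : R) by near: n; exact: near_ln_ge.
have Le : expR 1 <= ln (n%:R : R) by near: n; exact: near_ln_ge.
have grow : (4 * 4 ^+ l + 6) * ln (n%:R : R) ^+ (4 ^ l).+1 <= expR (ln n%:R / 2).
  by near: n; apply: near_ln_pow_le; rewrite addr_ge0 ?mulr_ge0 ?exprn_ge0.
move: pn; set L : R := ln n%:R in L64 sqrt_n Ll Lb Lt Le grow *; move=> /andP[pge ple].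
have L_def : L = ln n%:R by [].
clearbody L.
have L0 : 0 < L by apply: lt_le_trans L64.
have x0 : 0 < (2 * L + omega n) / n%:R by rewrite divr_gt0 //; lra.
have p_gt0 : 0 < p n by apply: lt_le_trans pge; rewrite sqrtr_gt0.
(* Squaring the lower bound on [p] gives [2 L + omega n <= n p ^ 2]. *)
have np2 : 1 <= n%:R * p n ^+ 2.
  have : (2 * L + omega n) / n%:R <= p n ^+ 2.
    rewrite -[leLHS]sqr_sqrtr ?(ltW x0) // lerXn2r ?nnegrE ?sqrtr_ge0 //.
    exact: ltW.
  by rewrite ler_pdivrMr // mulrC; lra.
have lnL : 1 <= ln L by rewrite -[leLHS]expRK ler_ln ?posrE ?expR_gt0.
have q_ge : 1 / L <= 1 - p n.
  apply: le_trans (_ : 3 * ln L / L <= _); last lra.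
  by rewrite ler_wpM2r ?invr_ge0 ?(ltW L0) //; lra.
have p01 : 0 <= p n <= 1.
  have : 0 < 1 / L by rewrite divr_gt0.
  by rewrite ltW //=; lra.
have low := gnp_lower_bound L_def erefl n0 L64 sqrt_n p_gt0 np2 q_ge.
have c01 : 0 < c < 1 by rewrite c0.
have upp : gnp_pr (p n) (fun G : graph 'I_n => ~~ ((loc_number G)%:R <=
    (1 - c * eta n (p n)) * (2 * L / ln (1 / rho (p n))))) <= 2 / n%:R.
  have [pt|/ltW pt] := lerP (ln (p n)) (- t).
    apply: (gnp_upper_bound_sparse L_def erefl n0 L64 sqrt_n p_gt0 np2 q_ge c01).
    have h : 0 <= 2 - 2 * c by rewrite subr_ge0 ler_piMr // ltW.
    by have := ler_wpM2l h pt; rewrite mulrN tc.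
  exact: (gnp_upper_bound_dense L_def erefl n0 L64 sqrt_n p_gt0 np2 q_ge c01
            t0 pt l_ge Ll Lb Lt grow).
rewrite ger0_norm ?subr_ge0 ?gnp_pr_le1 // -gnp_prC //.
apply: (@le_trans _ _ (2 / n%:R + 2 / n%:R)).
  apply: le_trans (lerD low upp); apply: le_trans (gnp_pr_or p01 _ _).
  by apply: gnp_pr_sub => // G; rewrite /= negb_and.
rewrite -mulrDl ler_pdivrMr // mulrC -ler_pdivrMr //.
by apply: le_trans en; rewrite -natrD.
Unshelve. all: by end_near. Qed.
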